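(* With probability one there exists $n_0$ such that for every $n\ge n_0$ the function $\mathbb R^3\ni(\alpha',\mu'_\varepsilon,\theta')\mapsto Q_n(\mathbf Y_n;\alpha',\mu'_\varepsilon,\theta')$ has a unique global minimizer, denoted $(\hat\alpha_n,\hat\mu_{\varepsilon,n},\hat\theta_n)$. Moreover, for every $(\alpha,\mu_\varepsilon,\theta)\in(0,1)\times(0,\infty)\times\mathbb N$, almost surely $\hat\alpha_n\to\alpha$, $\hat\mu_{\varepsilon,n}\to\mu_\varepsilon$ and $$\hat\theta_n\to Y_s-\frac{\alpha}{1+\alpha^2}(Y_{s-1}+Y_{s+1})-\frac{1-\alpha}{1+\alpha^2}\mu_\varepsilon\qquad(n\to\infty).$$
   Context: INAR(1) process: Let $\alpha\in(0,1)$. Let $(\varepsilon_k)_{k\in\mathbb N}$ be i.i.d. non-negative integer-valued random variables with $\mathbb E\varepsilon_1^2<\infty$ and $\mathbb P(\varepsilon_1\ne 0)>0$; write $\mu_\varepsilon=\mathbb E\varepsilon_1$ and $\sigma_\varepsilon^2=\operatorname{Var}\varepsilon_1$. For each $k\in\mathbb N$ let $(\xi_{k,j})_{j\in\mathbb N}$ be i.i.d. Bernoulli random variables with mean $\alpha$, these sequences being mutually independent and independent of $(\varepsilon_k)$. Let $X_0$ be a non-negative integer-valued random variable with $\mathbb E X_0^2<\infty$, independent of all $\xi_{k,j}$ and $\varepsilon_k$, and set $X_k=\sum_{j=1}^{X_{k-1}}\xi_{k,j}+\varepsilon_k$ for $k\in\mathbb N$. Additive outlier: fix a known time $s\in\mathbb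 N$ and size $\theta\in\mathbb N$, and let $Y_k=X_k+\delta_{k,s}\theta$, $k\in\mathbb Z_+$. Write $\mathbf Y_n=(Y_0,\dots,Y_n)$, $\mathbf y_n=(y_0,\dots,y_n)$. For $n\ge\max(3,s+1)$ and $\alpha',\mu'_\varepsilon,\theta'\in\mathbb R$, $$Q_n(\mathbf y_n;\alpha',\mu'_\varepsilon,\theta')=\sum_{\substack{k=1\\k\notin\{s,s+1\}}}^n(y_k-\alpha'y_{k-1}-\mu'_\varepsilon)^2+(y_s-\alpha'y_{s-1}-\mu'_\varepsilon-\theta')^2+(y_{s+1}-\alpha'y_s-\mu'_\varepsilon+\alpha'\theta')^2 .$$ *)

(* Defs.v *)
From HB Require Import structures.
From mathcomp Require Import all_boot all_order all_algebra.
From mathcomp Require Import all_classical all_reals all_analysis.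
Set Implicit Arguments. Unset Strict Implicit. Unset Printing Implicit Defensive.
Import Order.TTheory GRing.Theory Num.Theory.
Local Open Scope classical_set_scope.
Local Open Scope ring_scope.

(* Index type of all the basic random variables of the INAR(1) model:
   IX0 ~ X_0,  Ieps k ~ eps_{k+1},  Ixi k j ~ xi_{k+1, j+1}. *)
Inductive inar_idx := IX0 | Ieps of nat | Ixi of nat & nat.

Definition inar_idx_enc (i : inar_idx) : nat + (nat + (nat * nat)) :=
  match i with IX0 => inl 0%N | Ieps k => inr (inl k) | Ixi k j => inr (inr (k, j)) end.
Definition inar_idx_dec (x : nat + (nat + (nat * nat))) : inar_idx :=
  match x with inl _ => IX0 | inr (inl k) => Ieps k | inr (inr (k, j)) => Ixi k j end.
Lemma inar_idx_encK : cancel inar_idx_enc inar_idx_dec.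
Proof. by case. Qed.
HB.instance Definition _ := Equality.copy inar_idx (can_type inar_idx_encK).

Definition inar_family (T : Type) (X0 : T -> nat) (eps : nat -> T -> nat)
  (xi : nat -> nat -> T -> nat) (i : inar_idx) : T -> nat :=
  match i with
  | IX0 => X0
  | Ieps k => eps k.+1
  | Ixi k j => xi k.+1 j.+1
  end.

Definition nat_rv (d : measure_display) (T : measurableType d) (Z : T -> nat) :=
  forall m : nat, measurable (Z @^-1` [set m]).

Definition mutually_independent (d : measure_display) (T : measurableType d)
  (R : realType) (P : probability T R) (I : eqType) (Z : I -> T -> nat) :=
  forall (J : seq I), uniq J -> forall A : I -> set nat,
    P (\big[setI/setT]_(i <- J) (Z i @^-1` A i)) =
    (\prod_(i <- J) P (Z i @^-1` A i))%E.

Fixpoint inar_X (T : Type) (X0 : T -> nat) (eps : nat -> T -> nat)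
  (xi : nat -> nat -> T -> nat) (k : nat) (w : T) : nat :=
  match k with
  | 0 => X0 w
  | k'.+1 => (\sum_(1 <= j < (inar_X X0 eps xi k' w).+1) xi k'.+1 j w + eps k'.+1 w)%N
  end.

(* Observed process with an additive outlier of size theta at time s. *)
Definition inar_Y (R : realType) (T : Type) (X0 : T -> nat) (eps : nat -> T -> nat)
  (xi : nat -> nat -> T -> nat) (s theta : nat) (k : nat) (w : T) : R :=
  (inar_X X0 eps xi k w)%:R + (if k == s then theta%:R else 0).

Definition Qn (R : realType) (y : nat -> R) (s n : nat) (a m t : R) : R :=
  \sum_(1 <= k < n.+1 | (k != s) && (k != s.+1)) (y k - a * y k.-1 - m) ^+ 2
  + (y s - a * y s.-1 - m - t) ^+ 2
  + (y s.+1 - a * y s - m + a * t) ^+ 2.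

Definition is_global_minimizer (R : realType) (f : R -> R -> R -> R) (a m t : R) :=
  forall a' m' t', f a m t <= f a' m' t'.

Definition has_unique_global_minimizer (R : realType) (f : R -> R -> R -> R) :=
  exists a m t, is_global_minimizer f a m t /\
    forall a' m' t', is_global_minimizer f a' m' t' -> (a' = a /\ m' = m /\ t' = t).

(* Main.v *)
Require Import Defs.
From HB Require Import structures.
From mathcomp Require Import all_boot all_order all_algebra.
From mathcomp Require Import all_classical all_reals all_analysis.
From mathcomp Require Import measurable_realfun ring lra.
Import Order.TTheory GRing.Theory Num.Theory.
Set Implicit Arguments. Unset Strict Implicit. Unset Printing Implicit Defensive.
Local Open Scope classical_set_scope.
Import numFieldNormedType.Exports.
Local Open Scope ring_scope.

(* Write M_k = X_k - alpha X_{k-1} - mu. Conditionally on the past, X_k is distributed as a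
   sum of X_{k-1} Bernoulli variables and an independent innovation, so the partial sums of
   M_k and of X_{k-1} M_k are martingales and E X_k^2 stays bounded. Kolmogorov's maximal
   inequality on the blocks k <= 16^m, together with Borel-Cantelli, shows that both sums are
   o(n) almost surely; since X has only two moments, X_{k-1} is truncated at 8^m in the second
   sum, which almost surely changes only finitely many blocks. A third martingale counts the
   departures from the integer closest to the stationary mean c = mu / (1 - alpha) and bounds
   the empirical variance of X away from 0. So the least squares part of Q_n has curvature of
   order n in (alpha', mu') and a gradient o(n) at (alpha, mu): every minimizer is close to
   (alpha, mu) there, and minimizing the two remaining squares over theta' gives the last limit.
   Q_n is not convex because of the product alpha' theta', but this defect is bounded on the
   bounded set containing the minimizers, so the curvature of order n forces uniqueness. *)

(** * Random elements with countably many values *)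

Section DiscreteRandomElements.
Context (d : measure_display) (T : measurableType d) (R : realType).
Variable P : probability T R.

(** Testing singletons only spares a sigma-algebra on [U], which is later [nat], a product, or the
    type [seq nat] of trajectories. *)
Definition disc_rv (U : countType) (f : T -> U) :=
  forall u, measurable (f @^-1` [set u]).

Lemma disc_rv_preimage (U : countType) (f : T -> U) (A : set U) :
  disc_rv f -> measurable (f @^-1` A).
Proof.
move=> mf.
have -> : f @^-1` A = \bigcup_n (f @^-1` [set u | A u /\ pickle u = n]).
  by apply/seteqP; split=> [w Aw|w [n _ []//]]; exists (pickle (f w)).
apply: bigcupT_measurable => n.
have [[u [Au un]]|nu] := pselect (exists u, A u /\ pickle u = n).
  rewrite (_ : [set _ | _] = [set u]); first exact: mf.
  apply/seteqP; split=> [v [Av vn]|v ->//].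
  by apply: (pcan_inj pickleK); rewrite vn un.
rewrite (_ : [set _ | _] = set0) ?preimage_set0//.
by apply/seteqP; split=> // v Av; apply: nu; exists v.
Qed.

Lemma disc_rv_comp (U V : countType) (f : T -> U) (g : U -> V) :
  disc_rv f -> disc_rv (g \o f).
Proof. by move=> mf v; rewrite comp_preimage; exact: disc_rv_preimage. Qed.

Lemma disc_rv_pair (U V : countType) (f : T -> U) (g : T -> V) :
  disc_rv f -> disc_rv g -> disc_rv (fun w => (f w, g w)).
Proof.
move=> mf mg [u v].
rewrite (_ : _ @^-1` _ = f @^-1` [set u] `&` g @^-1` [set v]).
  exact: measurableI.
by apply/seteqP; split=> w /= [-> ->].
Qed.

Lemma disc_rv_measurable (U : countType) (f : T -> U) d' (V : measurableType d')
    (g : U -> V) (D : set T) :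
  disc_rv f -> measurable_fun D (fun w => g (f w)).
Proof.
move=> mf; apply: measurable_funTS => _ B _; rewrite setTI.
by rewrite -[X in measurable X]/(f @^-1` (g @^-1` B)); exact: disc_rv_preimage.
Qed.

Lemma integral_fibers (f : T -> nat) (g : T -> \bar R) (A : set T) :
  measurable A -> disc_rv f -> measurable_fun A g ->
  (forall w, A w -> (0 <= g w)%E) ->
  (\int[P]_(w in A) g w)%E =
  (\big[+%E/0]_(0 <= n <oo) \int[P]_(w in A `&` f @^-1` [set n]) g w)%E.
Proof.
move=> mA mf mg g0.
have AE : A = \bigcup_n (A `&` f @^-1` [set n]).
  by apply/seteqP; split=> [w Aw|w [n _ []//]]; exists (f w).
rewrite {1}AE ge0_integral_bigcup//.
- by move=> k; apply: measurableI => //; exact: mf.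
- by rewrite -AE.
- by rewrite -AE.
- by move=> i j _ _ [w [[_ /= <-] [_ /= <-]]].
Qed.

(** Reduces an equality of expectations to one value of [f] at a time. With [f] a trajectory, this
    is how conditioning on the whole past is carried out. *)
Lemma eq_integral_fibers (U : countType) (f : T -> U) (g1 g2 : T -> \bar R) :
  disc_rv f -> measurable_fun setT g1 -> measurable_fun setT g2 ->
  (forall w, (0 <= g1 w)%E) -> (forall w, (0 <= g2 w)%E) ->
  (forall u, \int[P]_(w in f @^-1` [set u]) g1 w =
             \int[P]_(w in f @^-1` [set u]) g2 w)%E ->
  (\int[P]_w g1 w)%E = (\int[P]_w g2 w)%E.
Proof.
move=> mf m1 m2 p1 p2 g12.
have mpf : disc_rv (pickle \o f) by exact: disc_rv_comp.
rewrite (integral_fibers measurableT mpf)//= [RHS](integral_fibers measurableT mpf)//=.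
apply: eq_eseriesr => n _; rewrite setTI.
have [[u un]|nu] := pselect (exists u : U, pickle u = n).
  rewrite (_ : _ @^-1` _ = f @^-1` [set u]) ?g12//.
  apply/seteqP; split=> [w /=|w /= ->//].
  by rewrite -un => /(pcan_inj pickleK).
rewrite (_ : _ @^-1` _ = set0) ?integral_set0//.
by apply/seteqP; split=> // w /= fw; apply: nu; exists (f w).
Qed.

End DiscreteRandomElements.

(** * Events independent of the variables outside an index set *)

Section Independence.
Context (d : measure_display) (T : measurableType d) (R : realType).
Variables (P : probability T R) (I : eqType) (Z : I -> T -> nat).
Hypothesis mZ : forall i, nat_rv (Z i).
Hypothesis indepZ : mutually_independent P Z.

Let cyl (L : seq I) (B : I -> set nat) := \big[setI/setT]_(i <- L) (Z i @^-1` B i).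

(** A stand-in for membership of [A] in the sigma-algebra generated by the variables with index in
    [J]: only the product rule that such membership would give is kept, tested on finite
    cylinders. *)
Definition indep_outside (J : set I) (A : set T) :=
  measurable A /\ forall (L : seq I) B, uniq L -> (forall i, i \in L -> ~ J i) ->
  P (A `&` cyl L B) = (P A * \prod_(i <- L) P (Z i @^-1` B i))%E.

Lemma indep_outside_setT : indep_outside set0 setT.
Proof.
split=> // L B uL _.
by rewrite setTI probability_setT mul1e; exact: indepZ.
Qed.

Lemma indep_outside_sub (J J' : set I) A :
  J `<=` J' -> indep_outside J A -> indep_outside J' A.
Proof.
move=> sJ [mA iA]; split=> // L B uL dL; apply: iA => // i iL Ji.
exact: (dL i iL (sJ _ Ji)).
Qed.

Lemma indep_outside_prob J A i B : indep_outside J A -> ~ J i ->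
  P (A `&` Z i @^-1` B) = (P A * P (Z i @^-1` B))%E.
Proof.
move=> [mA iA] Ji; have := iA [:: i] (fun=> B) isT.
rewrite /cyl !big_seq1; apply => j.
by rewrite inE => /eqP ->.
Qed.

Lemma indep_outside_setI J A i B : indep_outside J A -> ~ J i ->
  indep_outside (J `|` [set i]) (A `&` Z i @^-1` B).
Proof.
move=> iJA Ji; split.
  by apply: measurableI; [exact: iJA.1 | exact: (@disc_rv_preimage _ _ nat (Z i) B (mZ i))].
move=> L C uL dL.
have iL : i \notin L by apply/negP => /dL; apply; right.
(* [C'] imposes [B] at the new index [i] and agrees with [C] on [L], so the product rule for [A] can
   be applied to the longer list [i :: L]. *)
pose C' j := if j == i then B else C j.
have eqL j : j \in L -> Z j @^-1` C' j = Z j @^-1` C j.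
  by move=> jL; rewrite /C'; case: eqP => // ji; move: iL; rewrite -ji jL.
rewrite (indep_outside_prob _ iJA)// -setIA -muleA.
have := iJA.2 (i :: L) C'; rewrite /cyl /= !big_cons uL iL /C' eqxx.
rewrite (eq_big_seq _ eqL) (eq_big_seq (fun j => P (Z j @^-1` C j))); last first.
  by move=> j /eqL <-.
apply=> // j; rewrite inE => /orP[/eqP ->//|/dL jL Jj]; apply: jL; by left.
Qed.

Lemma indep_outside_cyl J A L B : indep_outside J A -> uniq L ->
  (forall i, i \in L -> ~ J i) -> indep_outside (J `|` [set` L]) (A `&` cyl L B).
Proof.
elim: L J A => [|i L IH] J A iA uL dL.
  rewrite /cyl big_nil setIT; apply: indep_outside_sub iA; exact: subsetUl.
move: uL => /= /andP[iL uL].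
rewrite /cyl big_cons setIA.
apply: indep_outside_sub; last first.
  apply: IH uL _; first by apply: indep_outside_setI iA _; apply: dL; exact: mem_head.
  move=> j jL [Jj|/= ji]; last by move: iL; rewrite -ji jL.
  by apply: dL Jj; rewrite inE jL orbT.
move=> j [[Jj|/= ->]|/= jL]; [by left|right|right].
  exact: mem_head.
by rewrite /= inE jL orbT.
Qed.

End Independence.

(** * The one-step transition law *)

Section INAR.
Context (R : realType) (d : measure_display) (T : measurableType d).
Variables (P : probability T R) (alpha mu : R).
Variables (X0 : T -> nat) (eps : nat -> T -> nat) (xi : nat -> nat -> T -> nat).
Let Z := inar_family X0 eps xi.
Let X := inar_X X0 eps xi.
Hypothesis alpha01 : 0 < alpha < 1.
Hypothesis mZ : forall i, nat_rv (Z i).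
Hypothesis indepZ : mutually_independent P Z.
Hypothesis eps_id : forall k m, (0 < k)%N ->
  P (eps k @^-1` [set m]) = P (eps 1%N @^-1` [set m]).
Hypothesis xi_bernoulli : forall k j, (0 < k)%N -> (0 < j)%N ->
  P (xi k j @^-1` [set 1%N]) = alpha%:E /\ P (xi k j @^-1` [set 0%N]) = (1 - alpha)%:E.

Definition inar_step k x w := (\sum_(1 <= j < x.+1) xi k j w + eps k w)%N.

Lemma inar_step0 k w : inar_step k 0 w = eps k w.
Proof. by rewrite /inar_step big_nil. Qed.

Lemma inar_stepS k x w : inar_step k x.+1 w = (inar_step k x w + xi k x.+1 w)%N.
Proof. by rewrite /inar_step big_nat_recr//= addnAC. Qed.

Lemma disc_rv_eps k : disc_rv (eps k.+1).
Proof. exact: (mZ (Ieps k)). Qed.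

Lemma disc_rv_xi k j : disc_rv (xi k.+1 j.+1).
Proof. exact: (mZ (Ixi k j)). Qed.

Lemma disc_rv_step k x : disc_rv (inar_step k.+1 x).
Proof.
elim: x => [|x IH].
  have -> : inar_step k.+1 0 = eps k.+1 by apply/funext => w; rewrite inar_step0.
  exact: disc_rv_eps.
have -> : inar_step k.+1 x.+1 =
    (fun p => (p.1 + p.2)%N) \o (fun w => (inar_step k.+1 x w, xi k.+1 x.+1 w)).
  by apply/funext => w; rewrite inar_stepS.
by apply: disc_rv_comp; apply: disc_rv_pair => //; exact: disc_rv_xi.
Qed.

(** The transition operator of the chain: the mean of [f] under the law of a Binomial([x], [alpha])
    variable plus an independent innovation. The binomial law is unrolled one Bernoulli variable at
    a time, so that moments are computed by induction on [x]. *)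
Fixpoint kern (x : nat) (f : nat -> \bar R) : \bar R :=
  match x with
  | 0 => (\int[P]_w f (eps 1%N w))%E
  | x'.+1 => (alpha%:E * kern x' (f \o succn) + (1 - alpha)%:E * kern x' f)%E
  end.

(** The masses at 0 and 1 already add up to 1. *)
Lemma xi_gt1_negligible k j : P (xi k.+1 j.+1 @^-1` [set m | (1 < m)%N]) = 0%E.
Proof.
have [p1 p0] := @xi_bernoulli k.+1 j.+1 isT isT.
have mp B : measurable (xi k.+1 j.+1 @^-1` B).
  exact: disc_rv_preimage (@disc_rv_xi k j).
set N := _ @^-1` _.
have : P setT = (P (xi k.+1 j.+1 @^-1` [set 0%N]) + (P (xi k.+1 j.+1 @^-1` [set 1%N]) + P N))%E.
  rewrite -(measureU P (mp [set 1%N]) (mp _ : measurable N)); last first.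
    by apply/seteqP; split=> // w [/= x1]; rewrite /N /= x1.
  rewrite -(measureU P (mp [set 0%N])); last 2 first.
  - by apply: measurableU; exact: mp.
  - by apply/seteqP; split=> // w [/= x0]; rewrite /N /= x0 => -[].
  congr (P _); apply/seteqP; split=> // w _.
  by rewrite /N /=; case: (xi _ _ w) => [|[|n]]; [left|right; left|right; right].
rewrite probability_setT p1 p0.
have : P N \is a fin_num by exact: fin_num_measure (mp _).
case: (P N) => // r _; rewrite -!EFinD => -[] H.
by congr EFin; lra.
Qed.

(** Induction on [x]: the value of the last thinning variable is moved into the event [A], its index
    into [J], and [f] is shifted accordingly. When no thinning variable is left, the integral is
    summed over the values of the innovation, whose law does not depend on [k]. *)
Lemma integral_step_kern k x J A (f : nat -> \bar R) :
  indep_outside P Z J A -> ~ J (Ieps k) -> (forall j, (j < x)%N -> ~ J (Ixi k j)) ->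
  (forall n, (0 <= f n)%E) ->
  (\int[P]_(w in A) f (inar_step k.+1 x w) = P A * kern x f)%E.
Proof.
elim: x J A f => [|x IH] J A f iA Je Jx f0.
  under eq_integral do rewrite inar_step0.
  have [mA _] := iA.
  have me n k' : measurable (eps k'.+1 @^-1` [set n]) by exact: disc_rv_eps.
  rewrite /= (integral_fibers P mA (@disc_rv_eps k))//; last first.
    exact: disc_rv_measurable (@disc_rv_eps k).
  rewrite (integral_fibers P measurableT (@disc_rv_eps 0%N))//; last first.
    exact: disc_rv_measurable (@disc_rv_eps 0%N).
  have fPA := fineK (fin_num_measure P A mA).
  rewrite -fPA -nneseriesZl//; last first.
    by move=> n _; exact: integral_ge0.
  rewrite fPA; apply: eq_eseriesr => n _.
  have H k' (B : set T) : measurable B ->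
     (\int[P]_(x0 in B `&` eps k'.+1 @^-1` [set n]) f (eps k'.+1 x0) =
      f n * P (B `&` eps k'.+1 @^-1` [set n]))%E.
    move=> mB; rewrite -integral_cst; last exact: measurableI.
    by apply: eq_integral => w /[!inE] -[_ /= ->].
  rewrite !H// setTI -(@eps_id k.+1)//.
  by rewrite (@indep_outside_prob _ _ _ _ _ _ _ _ (Ieps k) [set n] iA)// muleCA.
have [mA _] := iA.
have mxi B : measurable (xi k.+1 x.+1 @^-1` B).
  exact: disc_rv_preimage (@disc_rv_xi k x).
have mf D : measurable_fun D (fun w => f (inar_step k.+1 x.+1 w)).
  exact: disc_rv_measurable (@disc_rv_step k x.+1).
(* Up to a null event the last thinning variable is 0 or 1, which splits [A] into two disjoint
   pieces. *)
rewrite (ge0_negligible_integral (mxi [set m | (1 < m)%N]))//; last exact: xi_gt1_negligible.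
have -> : A `\` xi k.+1 x.+1 @^-1` [set m | (1 < m)%N] =
    (A `&` Z (Ixi k x) @^-1` [set 1%N]) `|` (A `&` Z (Ixi k x) @^-1` [set 0%N]).
  apply/seteqP; split=> [w [Aw /=]|w [[Aw /= ->]|[Aw /= ->]]//].
  by case: (xi _ _ w) => [|[|n]]//=; [right|left].
rewrite ge0_integral_setU//; last 3 first.
- by apply: measurableI => //; exact: mxi.
- by apply: measurableI => //; exact: mxi.
- by apply/disj_setPS => w [[_ /= ->] [_ //]].
have Jkx : ~ J (Ixi k x) by exact: Jx.
have step b : (\int[P]_(w in A `&` Z (Ixi k x) @^-1` [set b]) f (inar_step k.+1 x.+1 w) =
    P A * P (xi k.+1 x.+1 @^-1` [set b]) * kern x (fun n => f (n + b)%N))%E.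
  rewrite -(indep_outside_prob _ iA Jkx) -(IH (J `|` [set Ixi k x]))//.
  - by apply: eq_integral => w /[!inE] -[_ /= <-]; rewrite inar_stepS.
  - exact: indep_outside_setI.
  - by move=> [].
  - move=> j jx [|[]]; first by apply: Jx; exact: ltnW.
    by move=> ejx; rewrite ejx ltnn in jx.
rewrite !step.
have [-> ->] := @xi_bernoulli k.+1 x.+1 isT isT.
(* In the extended reals, the product with [P A] distributes over the two terms because both are
   non-negative. *)
have k0 y g : (forall n, 0 <= g n)%E -> (0 <= kern y g)%E.
  have /andP[a0 a1] := alpha01.
  elim: y g => [|y IHy] g g0 /=; first exact: integral_ge0.
  apply: adde_ge0; apply: mule_ge0.
  - by rewrite lee_fin ltW.
  - by apply: IHy => n; exact: g0.
  - by rewrite lee_fin subr_ge0 ltW.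
  - exact: IHy.
rewrite /= -!muleA -ge0_muleDr//; last 2 first.
- have /andP[a0 a1] := alpha01.
  by apply: mule_ge0; rewrite ?k0// lee_fin ltW.
- have /andP[a0 a1] := alpha01.
  by apply: mule_ge0; rewrite ?k0// lee_fin subr_ge0 ltW.
congr (_ * (_ * kern x _ + _ * kern x _))%E; apply/funext => n /=.
  by rewrite addn1.
by rewrite addn0.
Qed.

Lemma integral_step k x (f : nat -> \bar R) : (forall n, (0 <= f n)%E) ->
  (\int[P]_w f (inar_step k.+1 x w) = kern x f)%E.
Proof.
move=> f0; rewrite -[RHS]mul1e -(probability_setT P).
by apply: (integral_step_kern (indep_outside_setT indepZ)) => [[]|? _ []|].
Qed.

Lemma indep_outside_set0 J : indep_outside P Z J set0.
Proof. by split=> // L B _ _; rewrite set0I measure0 mul0e. Qed.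

Lemma prob_setI_step k x J A y : indep_outside P Z J A -> ~ J (Ieps k) ->
  (forall j, (j < x)%N -> ~ J (Ixi k j)) ->
  (P (A `&` inar_step k.+1 x @^-1` [set y]) = P A * kern x (fun n => (\1_[set y] n)%:E))%E.
Proof.
move=> iA Je Jx; have [mA _] := iA.
rewrite -(integral_step_kern iA Je Jx) => [|n]; last by rewrite lee_fin.
transitivity (\int[P]_(w in A) (\1_(inar_step k.+1 x @^-1` [set y]) w)%:E)%E => //.
rewrite integral_indic; [by rewrite setIC|exact: mA|exact: disc_rv_step].
Qed.

(** The cylinder is first absorbed into [A]. With and without it, the step then contributes the same
    [kern] factor, so the product rule for [A] passes to the intersection. *)
Lemma indep_outside_step k x J J' A y : indep_outside P Z J A ->
  ~ J (Ieps k) -> (forall j, (j < x)%N -> ~ J (Ixi k j)) ->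
  J `<=` J' -> J' (Ieps k) -> (forall j, (j < x)%N -> J' (Ixi k j)) ->
  indep_outside P Z J' (A `&` inar_step k.+1 x @^-1` [set y]).
Proof.
move=> iA Je Jx sJ J'e J'x; split.
  by apply: measurableI; [exact: iA.1|exact: disc_rv_step].
move=> L B uL dL.
have dJ i : i \in L -> ~ J i by move=> /dL J'i /sJ.
rewrite setIAC (prob_setI_step _ (indep_outside_cyl mZ B iA uL dJ)); last 2 first.
- by move=> [//|/dL/(_ J'e)].
- by move=> j jx [/(Jx _ jx)//|/dL/(_ (J'x _ jx))].
by rewrite (prob_setI_step _ iA)// iA.2// muleAC.
Qed.

(** * Trajectories, most recent state first, and the Markov property *)

Fixpoint inar_hist k w : seq nat :=
  match k with
  | 0 => [:: X0 w]
  | k'.+1 => inar_X X0 eps xi k'.+1 w :: inar_hist k' w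
  end.

Lemma head_hist k w : head 0%N (inar_hist k w) = X k w.
Proof. by case: k. Qed.

(** The indices [Ieps k'] and [Ixi k' _] drive the step from time [k'] to time [k'.+1], hence the
    strict inequality. *)
Let past k : set inar_idx := [set i |
  match i with IX0 => true | Ieps k' => (k' < k)%N | Ixi k' _ => (k' < k)%N end].

Lemma indep_hist k h : indep_outside P Z (past k) (inar_hist k @^-1` [set h]).
Proof.
elim: k h => [|k IH] h.
  have [[y ->]|nh] := pselect (exists y, h = [:: y]); last first.
    rewrite (_ : _ @^-1` _ = set0); first exact: indep_outside_set0.
    by apply/seteqP; split=> // w /= hw; apply: nh; exists (X0 w).
  rewrite (_ : _ @^-1` _ = setT `&` Z IX0 @^-1` [set y]).
    apply: (@indep_outside_sub _ _ _ _ _ _ (set0 `|` [set IX0])).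
      by move=> i [//|/= ->].
    by apply: (indep_outside_setI mZ _ (indep_outside_setT indepZ)) => -[].
  by rewrite setTI; apply/seteqP; split=> w /=; [case|move=> ->].
case: h => [|y h].
  rewrite (_ : _ @^-1` _ = set0); first exact: indep_outside_set0.
  by apply/seteqP; split.
(* Once the earlier trajectory is fixed to [h], the random number of thinning variables becomes the
   constant [head 0%N h]. *)
rewrite (_ : _ @^-1` _ =
  inar_hist k @^-1` [set h] `&` inar_step k.+1 (head 0%N h) @^-1` [set y]).
  apply: (indep_outside_step _ (IH h)) => /=.
  - by rewrite ltnn.
  - by move=> j _; rewrite ltnn.
  - by move=> [|k'|k' j]//= /ltnW.
  - exact: ltnSn.
  - by move=> j _; exact: ltnSn.
apply/seteqP; split=> w /=.
  by move=> [<- <-]; rewrite head_hist.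
by move=> [<- <-]; rewrite head_hist.
Qed.

Lemma disc_rv_hist k : disc_rv (inar_hist k).
Proof. by move=> h; have [] := indep_hist k h. Qed.

Lemma disc_rv_X k : disc_rv (X k).
Proof.
have -> : X k = head 0%N \o inar_hist k by apply/funext => w; rewrite /= head_hist.
exact/disc_rv_comp/disc_rv_hist.
Qed.

(* The Markov property, with the whole trajectory as state. *)
Lemma integral_hist k (f : seq nat -> nat -> \bar R) : (forall h y, (0 <= f h y)%E) ->
  (\int[P]_w f (inar_hist k w) (X k.+1 w) =
   \int[P]_w \int[P]_u f (inar_hist k w) (inar_step 1 (X k w) u))%E.
Proof.
move=> f0.
under [RHS]eq_integral do rewrite (@integral_step 0)// -head_hist.
pose g h := kern (head 0%N h) (f h).
have g0 h : (0 <= g h)%E by rewrite /g -(@integral_step 0)//; exact: integral_ge0.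
apply: (eq_integral_fibers (@disc_rv_hist k)) => //.
- exact: (@disc_rv_measurable _ _ _ (inar_hist k.+1) _ _
    (fun h => f (behead h) (head 0%N h)) _ (@disc_rv_hist k.+1)).
- exact: (disc_rv_measurable g (@disc_rv_hist k)).
- by move=> w; exact: g0.
move=> h.
transitivity (\int[P]_(w in inar_hist k @^-1` [set h]) f h (inar_step k.+1 (head 0%N h) w))%E.
  by apply: eq_integral => w /[!inE] /= <-; rewrite head_hist.
rewrite (integral_step_kern (indep_hist k h))//=; last 2 first.
- by rewrite ltnn.
- by move=> j _; rewrite ltnn.
rewrite muleC -integral_cst; last exact: disc_rv_hist.
by apply: eq_integral => w /[!inE] /= <-.
Qed.

(** * First and second moments of the chain *)

Hypothesis eps_sq : (\int[P]_w (((eps 1%N w)%:R : R) ^+ 2)%:E < +oo)%E.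
Hypothesis eps_mean : (\int[P]_w ((eps 1%N w)%:R : R)%:E = mu%:E)%E.
Hypothesis X0_sq : (\int[P]_w (((X0 w)%:R : R) ^+ 2)%:E < +oo)%E.

Let integrable_ge0 (f : T -> R) : measurable_fun setT f -> (forall w, 0 <= f w) ->
  (\int[P]_w (f w)%:E < +oo)%E -> P.-integrable setT (EFin \o f).
Proof.
move=> mf f0 fi; apply/integrableP; split; first exact/measurable_EFinP.
by under eq_integral do rewrite /= ger0_norm//.
Qed.

Let sigma2 := fine (\int[P]_w (((eps 1%N w)%:R : R) ^+ 2)%:E) - mu ^+ 2.

Lemma integral_eps_sq c :
  (\int[P]_w (((eps 1%N w)%:R - c) ^+ 2)%:E = ((mu - c) ^+ 2 + sigma2)%:E)%E.
Proof.
have me (f : nat -> R) : measurable_fun setT (fun w => f (eps 1%N w)).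
  exact: disc_rv_measurable (disc_rv_eps 0).
have i1 : P.-integrable setT (EFin \o (fun w => (eps 1%N w)%:R : R)).
  by apply: integrable_ge0 => //; rewrite eps_mean ltry.
have i2 : P.-integrable setT (EFin \o (fun w => ((eps 1%N w)%:R : R) ^+ 2)).
  by apply: integrable_ge0 => //; exact: (me (fun n => n%:R ^+ 2)).
have E2 : (\int[P]_w (((eps 1%N w)%:R : R) ^+ 2)%:E = (sigma2 + mu ^+ 2)%:E)%E.
  by rewrite /sigma2 subrK fineK// (integrable_fin_num _ i2).
transitivity (\int[P]_w ((((eps 1%N w)%:R : R) ^+ 2)%:E +
    ((- (2 * c))%:E * (eps 1%N w)%:R%:E + (c ^+ 2)%:E)))%E.
  apply: eq_integral => w _; rewrite -EFinM -!EFinD; congr EFin; ring.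
have i3 : P.-integrable setT (fun w => (- (2 * c))%:E * (eps 1%N w)%:R%:E)%E.
  exact: integrableZl.
have ic : P.-integrable setT (EFin \o cst (c ^+ 2)).
  exact: finite_measure_integrable_cst.
rewrite integralD//; last exact: integrableD.
rewrite integralD// integralZl// eps_mean E2 integral_cst//= probability_setT mule1.
by rewrite -EFinM -!EFinD; congr EFin; ring.
Qed.

Let sigma2_ge0 : 0 <= sigma2.
Proof.
have := integral_eps_sq mu; rewrite subrr expr0n add0r => H.
by rewrite -lee_fin -H; apply: integral_ge0 => w _; rewrite lee_fin sqr_ge0.
Qed.

(** Squared bias plus variance of one step. The centre [c] stays free in the induction on [x], since
    a Bernoulli success amounts to replacing [c] by [c - 1]. *)
Lemma integral_step_sq k x c :
  (\int[P]_w (((inar_step k.+1 x w)%:R - c) ^+ 2)%:E =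
   ((alpha * x%:R + mu - c) ^+ 2 + (alpha * (1 - alpha) * x%:R + sigma2))%:E)%E.
Proof.
rewrite (integral_step k x (f := fun n => ((n%:R - c) ^+ 2)%:E)); last first.
  by move=> n; rewrite lee_fin sqr_ge0.
elim: x c => [|x IH] c /=.
  by rewrite integral_eps_sq; congr EFin; ring.
rewrite IH (_ : _ \o _ = fun n => ((n%:R - (c - 1)) ^+ 2)%:E); last first.
  by apply/funext => n /=; congr EFin; rewrite -[n.+1]addn1 natrD; ring.
by rewrite IH -!EFinM -EFinD -[x.+1]addn1 natrD; congr EFin; ring.
Qed.

Lemma integral_step_mean k x :
  (\int[P]_w ((inar_step k.+1 x w)%:R : R)%:E = (alpha * x%:R + mu)%:E)%E.
Proof.
rewrite (integral_step k x (f := fun n => (n%:R)%:E)); last first.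
  by move=> n; rewrite lee_fin.
(* The added constant absorbs the shift caused by a success; its sign keeps the integrand
   non-negative. *)
suff: forall c, 0 <= c -> (kern x (fun n => (n%:R + c)%:E) = (alpha * x%:R + mu + c)%:E)%E.
  move=> /(_ 0 (lexx _)); rewrite addr0 => <-; congr (kern x _); apply/funext => n.
  by rewrite addr0.
elim: x => [|x IH] c c0 /=.
  under eq_integral do rewrite EFinD.
  rewrite ge0_integralD//; last first.
  - exact: (disc_rv_measurable (fun n => (n%:R : R)%:E) (disc_rv_eps 0)).
  rewrite eps_mean integral_cst//= probability_setT mule1 -EFinD; congr EFin; ring.
rewrite IH// (_ : _ \o _ = fun n => (n%:R + (c + 1))%:E); last first.
  by apply/funext => n /=; congr EFin; rewrite -[n.+1]addn1 natrD; ring.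
rewrite IH ?addr_ge0// -!EFinM -EFinD -[x.+1]addn1 natrD; congr EFin; ring.
Qed.

(** A drift argument: one step multiplies the second moment by at most [1 - eta / 2 < 1], up to the
    additive constant [K]. *)
Lemma integral_X_sq_bounded : exists M : R, 0 <= M /\
  forall k, (\int[P]_w (((X k w)%:R : R) ^+ 2)%:E <= M%:E)%E.
Proof.
have /andP[a0 a1] := alpha01.
set I0 := fine (\int[P]_w (((X0 w)%:R : R) ^+ 2)%:E).
have I0E : (\int[P]_w (((X0 w)%:R : R) ^+ 2)%:E = I0%:E)%E.
  rewrite fineK// ge0_fin_numE//; apply: integral_ge0 => w _; by rewrite lee_fin sqr_ge0.
have I0_ge0 : 0 <= I0.
  by rewrite -lee_fin -I0E; apply: integral_ge0 => w _; rewrite lee_fin sqr_ge0.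
pose eta := 1 - alpha ^+ 2; pose b := 2 * alpha * mu + alpha * (1 - alpha).
have eta0 : 0 < eta by rewrite /eta; nra.
(* Half of the contraction [eta] is spent on completing the square with the linear term [b * x],
   which leaves [b ^+ 2 / (2 * eta)]. *)
pose K := b ^+ 2 / (2 * eta) + mu ^+ 2 + sigma2.
have K0 : 0 <= K.
  rewrite /K; apply: addr_ge0 => //; apply: addr_ge0; last exact: sqr_ge0.
  by apply: divr_ge0; [exact: sqr_ge0|lra].
have bound (x : R) : (alpha * x + mu) ^+ 2 + (alpha * (1 - alpha) * x + sigma2) <=
    (1 - eta / 2) * x ^+ 2 + K.
  rewrite -subr_ge0 (_ : _ - _ = (eta * x - b) ^+ 2 / (2 * eta)).
    by apply: divr_ge0; [exact: sqr_ge0|lra].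
  have etaE : alpha ^+ 2 = 1 - eta by rewrite /eta; ring.
  rewrite /K (_ : (alpha * x + mu) ^+ 2 = alpha ^+ 2 * x ^+ 2 + 2 * alpha * mu * x + mu ^+ 2).
    rewrite etaE /b; field; exact: lt0r_neq0.
  by ring.
(* The fixed point of the recursion, raised by the initial moment; the recursion maps values below
   [M] to values below [M]. *)
pose M := I0 + K / (eta / 2).
have Ke : 0 <= K / (eta / 2) by apply: divr_ge0 => //; lra.
have M0 : 0 <= M by exact: addr_ge0.
exists M; split=> //; elim=> [|k IH].
  by rewrite /= I0E lee_fin lerDl.
rewrite (integral_hist k (f := fun _ y => ((y%:R : R) ^+ 2)%:E)); last first.
  by move=> _ y; rewrite lee_fin sqr_ge0.
apply: (@le_trans _ _ (\int[P]_w ((1 - eta / 2)%:E * (((X k w)%:R : R) ^+ 2)%:E + K%:E))%E).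
  apply: ge0_le_integral => //.
  - by move=> w _; apply: integral_ge0 => u _; rewrite lee_fin sqr_ge0.
  - exact: (disc_rv_measurable (fun x => \int[P]_u (((inar_step 1 x u)%:R : R) ^+ 2)%:E)%E
      (disc_rv_X k)).
  - exact: (disc_rv_measurable (fun x => (1 - eta / 2)%:E * ((x%:R : R) ^+ 2)%:E + K%:E)%E
      (disc_rv_X k)).
  move=> w _; rewrite -EFinM -EFinD.
  have := integral_step_sq 0 (X k w) 0; under eq_integral do rewrite subr0.
  by move=> ->; rewrite subr0 lee_fin; exact: bound.
have eta1 : 0 <= 1 - eta / 2 by rewrite /eta; nra.
rewrite ge0_integralD//; last 2 first.
- by move=> w _; rewrite -EFinM lee_fin mulr_ge0// sqr_ge0.
- exact: (disc_rv_measurable (fun x => (1 - eta / 2)%:E * ((x%:R : R) ^+ 2)%:E)%E (disc_rv_X k)).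
rewrite ge0_integralZl//; last first.
- exact: (disc_rv_measurable (fun x => ((x%:R : R) ^+ 2)%:E)%E (disc_rv_X k)).
rewrite integral_cst//= probability_setT mule1.
apply: (@le_trans _ _ ((1 - eta / 2)%:E * M%:E + K%:E)%E).
  by rewrite leeD2r// lee_wpmul2l.
rewrite -EFinM -EFinD lee_fin.
have -> : K = M * (eta / 2) - I0 * (eta / 2).
  by rewrite /M mulrDl addrAC subrr add0r divfK//; lra.
rewrite mulrBl mul1r; nra.
Qed.

(** * Martingales along a trajectory and the maximal inequality *)

Section Martingale.
Variable D : seq nat -> nat -> R.

(** [D h y] is the increment when the past [h] is prolonged by the state [y]; a list with one
    element is time 0. *)
Fixpoint mart (h : seq nat) : R :=
  if h is y :: h' then (if h' is [::] then 0 else mart h' + D h' y) else 0.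

(* [mart] frozen at the first time its modulus reaches l. *)
Fixpoint stopped (l : R) (h : seq nat) : R :=
  if h is y :: h' then
    (if h' is [::] then 0 else
     stopped l h' + (if l <= `|stopped l h'| then 0 else D h' y))
  else 0.

Lemma mart_hist n w :
  mart (inar_hist n w) = \sum_(1 <= k < n.+1) D (inar_hist k.-1 w) (X k w).
Proof.
elim: n => [|n IH]; first by rewrite big_nil.
rewrite big_nat_recr//= -IH.
by case: n {IH} => [|n].
Qed.

Lemma stopped_hist l n w : (exists2 k, (k <= n)%N & l <= `|mart (inar_hist k w)|) ->
  l <= `|stopped l (inar_hist n w)|.
Proof.
have stepE F k : (if inar_hist k w is [::] then 0 else F) = F :> R by case: k.
have S : l <= `|stopped l (inar_hist n w)| \/
    (stopped l (inar_hist n w) = mart (inar_hist n w) /\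
     forall k, (k <= n)%N -> ~~ (l <= `|mart (inar_hist k w)|)).
  elim: n => [|n [IH|[IH IHk]]].
  - case: (boolP (l <= `|mart (inar_hist 0 w)|)) => H; [by left|right; split=> // k].
    by rewrite leqn0 => /eqP ->.
  - by left; rewrite /= stepE IH addr0.
  - case: (boolP (l <= `|mart (inar_hist n.+1 w)|)) => H.
      left; rewrite [stopped _ _]/= stepE IH (negPf (IHk _ (leqnn _))).
      by move: H; rewrite /= stepE.
    right; split; first by rewrite /= !stepE IH (negPf (IHk _ (leqnn _))).
    by move=> k; rewrite leq_eqVlt => /orP[/eqP ->//|]; exact: IHk.
case: S => // -[_ S] [k kn H].
by have := S k kn; rewrite H.
Qed.

Variable v : seq nat -> R.
Hypothesis v_ge0 : forall h, 0 <= v h.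
Hypothesis D_integrable : forall h,
  P.-integrable setT (fun w => (D h (inar_step 1 (head 0%N h) w))%:E).
Hypothesis D_centered : forall h,
  (\int[P]_w (D h (inar_step 1 (head 0%N h) w))%:E = 0)%E.
Hypothesis D_var : forall h,
  (\int[P]_w (D h (inar_step 1 (head 0%N h) w) ^+ 2)%:E <= (v h)%:E)%E.

Lemma integral_increment_sq (s : R) h :
  (\int[P]_w ((s + D h (inar_step 1 (head 0%N h) w)) ^+ 2)%:E <= (s ^+ 2 + v h)%:E)%E.
Proof.
set E := fun w => D h (inar_step 1 (head 0%N h) w).
have i2 : P.-integrable setT (fun w => (E w ^+ 2)%:E).
  apply: (@integrable_ge0 (fun w => E w ^+ 2)); last 2 first.
  - by move=> w; exact: sqr_ge0.
  - by apply: le_lt_trans (D_var h) _; rewrite ltry.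
  exact: (disc_rv_measurable (fun y => D h y ^+ 2) (disc_rv_step 0 (head 0%N h))).
have i1 : P.-integrable setT (fun w => (2 * s)%:E * (E w)%:E)%E.
  by apply: integrableZl => //; exact: D_integrable.
have ic : P.-integrable setT (EFin \o cst (s ^+ 2)) by exact: finite_measure_integrable_cst.
have -> : (\int[P]_w ((s + D h (inar_step 1 (head 0%N h) w)) ^+ 2)%:E =
    \int[P]_w ((E w ^+ 2)%:E + ((2 * s)%:E * (E w)%:E + (s ^+ 2)%:E)))%E.
  by apply: eq_integral => w _; rewrite -EFinM -!EFinD /E; congr EFin; ring.
have iE : P.-integrable setT (fun w => (E w)%:E) by exact: D_integrable.
have E0 : (\int[P]_w (E w)%:E = 0)%E by exact: D_centered.
rewrite integralD//; last exact: integrableD.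
rewrite integralD// integralZl// E0 mule0 add0e integral_cst//= probability_setT mule1.
by rewrite addeC EFinD leeD2l// D_var.
Qed.

(* Conditioning on the whole trajectory makes the cross term vanish pointwise, by
   [integral_increment_sq], so that no integrability of the partial sums is needed. *)
Lemma integral_stopped_sq (l B : R) n :
  (forall k, (k < n)%N -> (\int[P]_w (v (inar_hist k w))%:E <= B%:E)%E) ->
  (\int[P]_w (stopped l (inar_hist n w) ^+ 2)%:E <= (n%:R * B)%:E)%E.
Proof.
elim: n => [|n IH] vB.
  by rewrite /= expr0n mul0r integral0.
pose f h y : \bar R := (if h is [::] then 0 else
  (stopped l h + (if l <= `|stopped l h| then 0 else D h y)) ^+ 2)%:E.
have f0 h y : (0 <= f h y)%E.
  by rewrite /f lee_fin; case: h => // *; exact: sqr_ge0.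
have -> : (\int[P]_w (stopped l (inar_hist n.+1 w) ^+ 2)%:E =
    \int[P]_w f (inar_hist n w) (X n.+1 w))%E.
  by apply: eq_integral => w _; rewrite /f /=; case: n {IH vB}.
rewrite integral_hist//.
apply: (@le_trans _ _ (\int[P]_w ((stopped l (inar_hist n w) ^+ 2)%:E + (v (inar_hist n w))%:E))%E).
  apply: ge0_le_integral => //.
  - by move=> w _; exact: integral_ge0.
  - have := disc_rv_measurable (D := setT)
      (fun h => \int[P]_u f h (inar_step 1 (head 0%N h) u))%E (disc_rv_hist n).
    by under eq_fun do rewrite head_hist.
  - exact: (disc_rv_measurable (fun h => (stopped l h ^+ 2)%:E + (v h)%:E)%E (disc_rv_hist n)).
  move=> w _; rewrite -head_hist /f.
  case: (inar_hist n w) => [|y h]; first by rewrite integral0 adde_ge0// lee_fin// sqr_ge0.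
  move: (stopped l (y :: h)) => s.
  case: (l <= `|s|); last by rewrite -EFinD; exact: integral_increment_sq.
  rewrite addr0 integral_cst//= probability_setT mule1.
  by rewrite leeDl// lee_fin.
rewrite ge0_integralD//; last 4 first.
- by move=> w _; rewrite lee_fin sqr_ge0.
- exact: (disc_rv_measurable (fun h => (stopped l h ^+ 2)%:E)%E (disc_rv_hist n)).
- by move=> w _; rewrite lee_fin.
- exact: (disc_rv_measurable (fun h => (v h)%:E)%E (disc_rv_hist n)).
rewrite -natr1 mulrDl mul1r EFinD leeD//; last exact: vB.
by apply: IH => k kn; apply: vB; exact: ltnW.
Qed.

Lemma kolmogorov_maximal (l B : R) n : 0 < l ->
  (forall k, (k < n)%N -> (\int[P]_w (v (inar_hist k w))%:E <= B%:E)%E) ->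
  (P [set w | exists2 k, (k <= n)%N & (l <= `|mart (inar_hist k w)|)%R] <=
   (n%:R * B / l ^+ 2)%:E)%E.
Proof.
move=> l0 vB; set A := [set w | _].
pose A' := [set w | l <= `|stopped l (inar_hist n w)|].
have mA' : measurable A'.
  exact: (disc_rv_preimage [set h | l <= `|stopped l h|] (disc_rv_hist n)).
have mA : measurable A.
  have -> : A = \bigcup_k [set w | (k <= n)%N /\ l <= `|mart (inar_hist k w)|].
    by apply/seteqP; split=> [w [k kn H]|w [k _ [kn H]]]; exists k.
  apply: bigcupT_measurable => k.
  exact: (disc_rv_preimage [set h | (k <= n)%N /\ l <= `|mart h|] (disc_rv_hist k)).
have PA : (P A <= P A')%E.
  by apply: le_measure; rewrite ?inE// => w; exact: stopped_hist.
apply: le_trans PA _.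
have l2 : 0 < l ^+ 2 by exact: exprn_gt0.
rewrite EFinM lee_pdivlMr// muleC -integral_cst//.
apply: le_trans (integral_stopped_sq l vB).
have mS (C : set T) : measurable_fun C (fun w => (stopped l (inar_hist n w) ^+ 2)%:E).
  exact: (disc_rv_measurable (fun h => (stopped l h ^+ 2)%:E)%E (disc_rv_hist n)).
apply: (@le_trans _ _ (\int[P]_(w in A') (stopped l (inar_hist n w) ^+ 2)%:E)%E).
  apply: ge0_le_integral => //.
  - by move=> w _; rewrite lee_fin sqr_ge0.
  - by move=> w A'w; rewrite lee_fin -[leRHS]real_normK ?num_real// lerXn2r ?nnegrE// ltW.
by apply: ge0_subset_integral => // w _; rewrite lee_fin sqr_ge0.
Qed.
End Martingale.

(** * Borel-Cantelli and almost sure bounds on the blocks *)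

Lemma ae_eventually_notin (E : nat -> set T) (C q : R) : 0 <= q < 1 ->
  (forall m, measurable (E m)) -> (forall m, (P (E m) <= (C * q ^+ m)%:E)%E) ->
  {ae P, forall w, exists m0, forall m, (m0 <= m)%N -> ~ E m w}.
Proof.
move=> /andP[q0 q1] mE PE.
have C0 : 0 <= C.
  by have := le_trans (measure_ge0 P (E 0%N)) (PE 0%N); rewrite expr0 mulr1 lee_fin.
have H : P (lim_sup_set E) = 0%E.
  apply: lim_sup_set_cvg0 => //.
  apply: (@le_lt_trans _ _ (\big[+%E/0]_(0 <= m <oo) (C * q ^+ m)%:E)%E).
    by apply: lee_nneseries => // m *; exact: PE.
  rewrite (_ : (\big[+%E/0]_(0 <= m <oo) _)%E = (C * (1 - q)^-1)%:E) ?ltry//.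
  apply/cvg_lim => //; apply: cvg_EFin.
    by apply: nearW => n; rewrite sumEFin.
  rewrite (_ : _ \o _ = series (geometric C q)).
    by apply: cvg_geometric_series; rewrite ger0_norm.
  by apply/funext => n /=; rewrite sumEFin.
exists (lim_sup_set E); split=> //.
  by apply: bigcap_measurable => // n _; exact: bigcup_measurable.
move=> w /= H' n _; apply: contrapT => nE; apply: H'; exists n => m nm Em.
by apply: nE; exists m.
Qed.


(* Bounds of order 12^m are o(16^m), while the maximal inequality bounds the probability of
   exceeding them by B * 16^m * 8^m / 144^m = B * (8/9)^m. *)
Lemma ae_mart_lt (D : nat -> seq nat -> nat -> R) (v : nat -> seq nat -> R) (B : R) :
  (forall m h, 0 <= v m h) ->
  (forall m h, P.-integrable setT (fun w => (D m h (inar_step 1 (head 0%N h) w))%:E)) ->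
  (forall m h, \int[P]_w (D m h (inar_step 1 (head 0%N h) w))%:E = 0)%E ->
  (forall m h, \int[P]_w (D m h (inar_step 1 (head 0%N h) w) ^+ 2)%:E <= (v m h)%:E)%E ->
  (forall m k, \int[P]_w (v m (inar_hist k w))%:E <= (B * 8 ^+ m)%:E)%E ->
  {ae P, forall w, exists m0, forall m, (m0 <= m)%N -> forall k, (k <= 16 ^ m)%N ->
    `|mart (D m) (inar_hist k w)| < 12 ^+ m}.
Proof.
move=> v0 iD D0 Dv vB.
pose E m := [set w | exists2 k, (k <= 16 ^ m)%N & 12 ^+ m <= `|mart (D m) (inar_hist k w)|].
have mE m : measurable (E m).
  have -> : E m = \bigcup_k [set w | (k <= 16 ^ m)%N /\ 12 ^+ m <= `|mart (D m) (inar_hist k w)|].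
    by apply/seteqP; split=> [w [k kn H]|w [k _ [kn H]]]; exists k.
  apply: bigcupT_measurable => k.
  exact: (disc_rv_preimage [set h | (k <= 16 ^ m)%N /\ 12 ^+ m <= `|mart (D m) h|]
    (disc_rv_hist k)).
have PE m : (P (E m) <= (B * (8 / 9) ^+ m)%:E)%E.
  apply: le_trans (kolmogorov_maximal (v0 m) (iD m) (D0 m) (Dv m) (l := 12 ^+ m)
    (B := B * 8 ^+ m) (n := 16 ^ m) _ _) _ => //.
  rewrite lee_fin natrX -exprM mulnC exprM mulrCA -mulrA -exprMn -expr_div_n.
  by rewrite (_ : 16 * 8 / 12 ^+ 2 = 8 / 9 :> R)//; field.
apply: filterS (@ae_eventually_notin E B (8 / 9) _ mE PE); last by lra.
move=> w [m0 H]; exists m0 => m mm k kn; rewrite ltNge; apply/negP => G.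
by apply: (H m mm); exists k.
Qed.

(** Markov's inequality for the second moment bounds each exceedance by [M / 64 ^+ m]. A block has
    at most [2 * 16 ^ m] times, so the union bound is of order [4 ^ (- m)], which is summable. *)
Lemma ae_X_le : {ae P, forall w, exists m0, forall m, (m0 <= m)%N ->
  forall k, (k <= 16 ^ m)%N -> (X k w <= 8 ^ m)%N}.
Proof.
have [M [M0 XM]] := integral_X_sq_bounded.
pose E m := \big[setU/set0]_(k < (16 ^ m).+1) [set w | (8 ^ m < X k w)%N].
have mX m k : measurable [set w | (8 ^ m < X k w)%N].
  exact: (disc_rv_preimage [set x | (8 ^ m < x)%N] (disc_rv_X k)).
have mE m : measurable (E m) by apply: bigsetU_measurable => k _; exact: mX.
have PX m k : (P [set w | (8 ^ m < X k w)%N] <= (M / 64 ^+ m)%:E)%E.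
  have l2 : 0 < 64 ^+ m :> R by exact: exprn_gt0.
  rewrite EFinM lee_pdivlMr// muleC -integral_cst//.
  apply: le_trans (XM k).
  have mS (C : set T) : measurable_fun C (fun w => (((X k w)%:R : R) ^+ 2)%:E).
    exact: (disc_rv_measurable (fun x => ((x%:R : R) ^+ 2)%:E)%E (disc_rv_X k)).
  apply: (@le_trans _ _ (\int[P]_(w in [set w | (8 ^ m < X k w)%N]) (((X k w)%:R : R) ^+ 2)%:E)%E).
    apply: ge0_le_integral => // [w _|w /= Xw]; first by rewrite lee_fin ltW.
    rewrite lee_fin -natrX -natrX ler_nat (_ : 64 = 8 ^ 2)%N// -expnM mulnC expnM.
    by rewrite leq_exp2r// ltnW.
  by apply: ge0_subset_integral => // w _; rewrite lee_fin sqr_ge0.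
have PE m : (P (E m) <= (2 * M * (1 / 4) ^+ m)%:E)%E.
  apply: le_trans (le_mu_bigsetU P (A := fun k => [set w | (8 ^ m < X k w)%N])
    (n := (16 ^ m).+1) _) _ => //.
  apply: (@le_trans _ _ (\sum_(k < (16 ^ m).+1) (M / 64 ^+ m)%:E)%E).
    by apply: lee_sum => k _; exact: PX.
  rewrite sumEFin lee_fin sumr_const card_ord -[leLHS]mulr_natl.
  apply: (@le_trans _ _ (2 * 16 ^+ m * (M / 64 ^+ m))).
    rewrite ler_wpM2r ?divr_ge0// -natrX -natrM ler_nat.
    by rewrite mul2n -addnn -addn1 leq_add2l expn_gt0.
  rewrite (_ : 2 * 16 ^+ m * _ = 2 * M * (16 ^+ m / 64 ^+ m)); last by ring.
  by rewrite -expr_div_n (_ : 16 / 64 = 1 / 4 :> R)//; field.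
apply: filterS (@ae_eventually_notin E (2 * M) (1 / 4) _ mE PE); last by lra.
move=> w [m0 H]; exists m0 => m mm k kn; rewrite leqNgt; apply/negP => G.
apply: (H m mm).
exact: (bigsetU_sup (F := fun k => [set w | (8 ^ m < X k w)%N]) (kn : (k < (16 ^ m).+1)%N)).
Qed.

(** If [n] lies between [16 ^ m] and [16 ^ m.+1], the quotient is at most [12 ^+ m.+1 / 16 ^+ m],
    that is [12 * (3 / 4) ^+ m]. *)
Lemma cvg_div_of_blocks (a : nat -> R) : (exists m0, forall m, (m0 <= m)%N ->
  forall n, (n <= 16 ^ m)%N -> `|a n| <= 12 ^+ m) -> (fun n => a n / n%:R) @ \oo --> (0 : R).
Proof.
move=> [m0 H]; apply/cvgrPdist_le => e e0.
have [m1 _ Hm1] : \forall m \near \oo, geometric (12 : R) (3 / 4) m <= e.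
  have : geometric (12 : R) (3 / 4) @ \oo --> (0 : R).
    by apply: cvg_geometric; rewrite ger0_norm; lra.
  move/cvgrPdist_le => /(_ e e0); apply: filterS => m; rewrite sub0r normrN.
  exact: le_trans (ler_norm _).
exists (16 ^ maxn m0 m1)%N => // n /= nm.
have n0 : (0 < n)%N by apply: leq_trans nm; rewrite expn_gt0.
have /andP[n1 n2] := @trunc_log_bounds 16 n isT n0.
set m := trunc_log 16 n in n1 n2.
have mm : (maxn m0 m1 <= m)%N.
  by rewrite -ltnS -(@ltn_exp2l 16)//; exact: leq_ltn_trans nm n2.
rewrite geq_max in mm; case/andP: mm => mm0 mm1.
have an : `|a n| <= 12 ^+ m.+1 by apply: H (ltnW n2); exact: leqW.
rewrite sub0r normrN normrM normfV (ger0_norm (ler0n _ _)) ler_pdivrMr ?ltr0n//.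
apply: le_trans an _; apply: le_trans (_ : geometric (12 : R) (3 / 4) m * 16 ^+ m <= _).
  rewrite /geometric /= -mulrA -exprMn exprS.
  by rewrite (_ : 3 / 4 * 16 = 12 :> R)//; field.
rewrite ler_pM ?exprn_ge0//; last by rewrite -natrX ler_nat.
- by rewrite /geometric /= mulr_ge0// exprn_ge0//; lra.
- exact: Hm1.
Qed.

Lemma integral_v_le (v : seq nat -> R) (b c M : R) :
  (forall k, (\int[P]_w (((X k w)%:R : R) ^+ 2)%:E <= M%:E)%E) ->
  0 <= b -> 0 <= c -> (forall h, 0 <= v h <= b * ((head 0%N h)%:R : R) ^+ 2 + c) ->
  forall k, (\int[P]_w (v (inar_hist k w))%:E <= (b * M + c)%:E)%E.
Proof.
move=> XM b0 c0 vle k.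
have m2 : measurable_fun setT (fun w => (((X k w)%:R : R) ^+ 2)%:E).
  exact: (disc_rv_measurable (fun x => ((x%:R : R) ^+ 2)%:E) (disc_rv_X k)).
apply: (@le_trans _ _ (\int[P]_w (b%:E * (((X k w)%:R : R) ^+ 2)%:E + c%:E))%E).
  apply: ge0_le_integral => //.
  - by move=> w _; have /andP[] := vle (inar_hist k w); rewrite lee_fin.
  - exact: (disc_rv_measurable (fun h => (v h)%:E) (disc_rv_hist k)).
  - exact: (disc_rv_measurable (fun x => b%:E * ((x%:R : R) ^+ 2)%:E + c%:E)%E (disc_rv_X k)).
  move=> w _; have /andP[_] := vle (inar_hist k w).
  by rewrite head_hist -EFinM -EFinD lee_fin.
rewrite ge0_integralD//; last 2 first.
- by move=> w _; rewrite -EFinM lee_fin mulr_ge0// sqr_ge0.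
- exact: (disc_rv_measurable (fun x => b%:E * ((x%:R : R) ^+ 2)%:E)%E (disc_rv_X k)).
rewrite ge0_integralZl//.
by rewrite integral_cst//= probability_setT mule1 EFinD EFinM leeD2r// lee_wpmul2l.
Qed.

(** The conditional variance of the increment is the left side of the hypothesis on [g], by
    [integral_step_sq]; its mean is of order [8 ^+ m] because the second moments of the chain are
    bounded. The weight may depend on the block [m], which leaves room for truncation. *)
Lemma ae_weighted_mart_lt (g : nat -> seq nat -> R) (B : R) : 0 <= B ->
  (forall m h, g m h ^+ 2 * (alpha * (1 - alpha) * (head 0%N h)%:R + sigma2) <=
     8 ^+ m * B * (((head 0%N h)%:R) ^+ 2 + 1)) ->
  {ae P, forall w, exists m0, forall m, (m0 <= m)%N -> forall k, (k <= 16 ^ m)%N ->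
    `|mart (fun h y => g m h * (y%:R - (alpha * (head 0%N h)%:R + mu))) (inar_hist k w)| < 12 ^+ m}.
Proof.
move=> B0 gB.
have /andP[a0 a1] := alpha01.
have [M [M0 XM]] := integral_X_sq_bounded.
have v0 m h : 0 <= g m h ^+ 2 * (alpha * (1 - alpha) * (head 0%N h)%:R + sigma2).
  rewrite mulr_ge0 ?sqr_ge0// addr_ge0// mulr_ge0//; nra.
have iV x : P.-integrable setT (fun w => ((inar_step 1 x w)%:R : R)%:E).
  apply: (@integrable_ge0 (fun w => (inar_step 1 x w)%:R)) => //.
    exact: (disc_rv_measurable (fun n => n%:R : R) (disc_rv_step 0 x)).
  by rewrite integral_step_mean ltry.
have iD x c : P.-integrable setT (fun w => ((inar_step 1 x w)%:R - c)%:E).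
  have -> : (fun w => ((inar_step 1 x w)%:R - c)%:E) =
      (fun w => ((inar_step 1 x w)%:R : R)%:E - (cst c w)%:E)%E by apply/funext.
  apply: integrableB => //; exact: finite_measure_integrable_cst.
have D0 x : (\int[P]_w ((inar_step 1 x w)%:R - (alpha * x%:R + mu))%:E = 0)%E.
  under eq_integral do rewrite EFinB.
  rewrite integralB//; last exact: finite_measure_integrable_cst.
  by rewrite integral_step_mean integral_cst//= probability_setT mule1 subee.
apply: (@ae_mart_lt _ (fun m h => g m h ^+ 2 * (alpha * (1 - alpha) * (head 0%N h)%:R + sigma2))
  (B * (M + 1))) => //.
- move=> m h.
  have -> : (fun w => (g m h * ((inar_step 1 (head 0%N h) w)%:R -
        (alpha * (head 0%N h)%:R + mu)))%:E) =
      (fun w => (g m h)%:E * ((inar_step 1 (head 0%N h) w)%:R -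
        (alpha * (head 0%N h)%:R + mu))%:E)%E by apply/funext.
  by apply: integrableZl => //; exact: iD.
- move=> m h; under eq_integral do rewrite EFinM.
  by rewrite integralZl// ?D0 ?mule0//; exact: iD.
- move=> m h; under eq_integral do rewrite exprMn EFinM.
  rewrite ge0_integralZl//; last 3 first.
  + exact: (disc_rv_measurable (fun n => ((n%:R - (alpha * (head 0%N h)%:R + mu)) ^+ 2)%:E)
      (disc_rv_step 0 (head 0%N h))).
  + by move=> w _; rewrite lee_fin sqr_ge0.
  + by rewrite lee_fin sqr_ge0.
  by rewrite integral_step_sq subrr expr0n add0r -EFinM.
- move=> m k.
  have Bm0 : 0 <= 8 ^+ m * B by rewrite mulr_ge0// exprn_ge0.
  have vle h : 0 <= g m h ^+ 2 * (alpha * (1 - alpha) * (head 0%N h)%:R + sigma2) <=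
      8 ^+ m * B * ((head 0%N h)%:R) ^+ 2 + 8 ^+ m * B.
    by rewrite v0/=; apply: le_trans (gB m h) _; rewrite mulrDr mulr1.
  apply: le_trans (integral_v_le XM Bm0 Bm0 vle k) _.
  by rewrite lee_fin le_eqVlt; apply/orP; left; apply/eqP; ring.
Qed.

(* Each departure from N is followed by a time at which the chain is not at N, so the time
   spent away from N has positive density even if the chain stays at N most of the time. *)
Lemma visits_lower (x : nat -> nat) (N : nat) (c p : R) : 0 < p <= 1 ->
  (forall y, y != N -> 1 / 4 <= (y%:R - c) ^+ 2) ->
  ((fun n => (\sum_(1 <= k < n.+1)
     (if x k.-1 == N then (x k != N)%:R - p else 0)) / n%:R) @ \oo --> (0 : R)) ->
  \forall n \near \oo, p / 32 * n%:R <= \sum_(1 <= k < n.+1) ((x k.-1)%:R - c) ^+ 2.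
Proof.
move=> /andP[p0 p1] Nc tn.
have [n1 _ Hn1] : \forall n \near \oo,
    `|(\sum_(1 <= k < n.+1) (if x k.-1 == N then (x k != N)%:R - p else 0)) / n%:R| <= p / 2.
  by move/cvgrPdist_le : tn => /(_ (p / 2)); rewrite divr_gt0// => /(_ isT);
    apply: filterS => n; rewrite sub0r normrN.
have p4 : 4 / p < (Num.bound (4 / p))%:R by apply: archi_boundP; rewrite divr_ge0// ltW.
set n2 := Num.bound _ in p4.
exists (maxn n1 n2.+1) => // n /= nn.
have n1n : (n1 <= n)%N by apply: leq_trans nn; exact: leq_maxl.
have n2n : (n2 < n)%N by apply: leq_trans nn; exact: leq_maxr.
have n0 : 0 < n%:R :> R by rewrite ltr0n; exact: leq_trans n2n.
have pn : 4 <= p * n%:R.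
  rewrite mulrC -ler_pdivrMr//; apply: le_trans (ltW p4) _.
  by rewrite ler_nat ltnW.
have := Hn1 n n1n; rewrite normrM normfV (gtr0_norm n0) ler_pdivrMr//.
set t := \sum_(1 <= k < n.+1) _; set S := \sum_(1 <= k < n.+1) _ => tle.
pose f j : R := (x j != N)%:R.
have f1 j : f j <= 1 by rewrite /f lern1; case: (_ != _).
have f0 j : 0 <= f j by rewrite /f.
(* Let [F] and [G] be the times spent away from [N] before and after each step. The departures
   number [t + p * (n - F)] and are at most [G <= F + 1]. With [t >= - p * n / 2] and [p * n >= 4]
   this gives [F >= p * n / 8], and [F <= 4 * S] yields the factor 32. *)
have H1 : t + p * n%:R - p * \sum_(1 <= k < n.+1) f k.-1 <= \sum_(1 <= k < n.+1) f k.
  have -> : n%:R = \sum_(1 <= k < n.+1) 1 :> R by rewrite sumr_const_nat subn1.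
  rewrite !mulr_sumr -big_split -sumrB /=; apply: ler_sum => k _.
  rewrite /f; case: (x k.-1 == N) => /=; first by lra.
  by rewrite mulr1 add0r subrr.
have H2 : \sum_(1 <= k < n.+1) f k <= \sum_(1 <= k < n.+1) f k.-1 + 1.
  rewrite -lerBlDl -sumrB big_add1 /= telescope_sumr//.
  by have := f0 0%N; have := f1 n; lra.
have H3 : \sum_(1 <= k < n.+1) f k.-1 <= 4 * S.
  rewrite mulr_sumr; apply: ler_sum => k _; rewrite /f.
  case: eqP => [_|/eqP /Nc] /=; last by lra.
  by rewrite mulr_ge0// sqr_ge0.
have S0 : 0 <= S by apply: sumr_ge0 => k _; exact: sqr_ge0.
move: tle; rewrite ler_norml => /andP[tl _].
move: H1 H2 H3 tl; set F := \sum_(1 <= k < n.+1) f k.-1; set G := \sum_(1 <= k < n.+1) f k.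
by move=> *; nra.
Qed.

(** * Departures from an integer and the almost sure limits *)

Hypothesis eps_nz : (0 < P (eps 1%N @^-1` [set m | m != 0%N]))%E.

(** Some [m != 0] has positive mass under the innovation law, since otherwise a non-zero innovation
    would be a countable union of null events. From [N] the chain then reaches [m + N] with positive
    probability, when all [N] thinning variables equal 1. *)
Lemma step_leaves (N : nat) : exists p : R, 0 < p <= 1 /\
  (\int[P]_w ((inar_step 1 N w != N)%:R : R)%:E = p%:E)%E.
Proof.
have /andP[a0 a1] := alpha01.
have [m [m0 Pm]] : exists m : nat, m != 0%N /\ (0 < P (eps 1%N @^-1` [set m]))%E.
  apply: contrapT => H; move: eps_nz; rewrite lt0e => /andP[/eqP + _]; apply.
  have mE B : measurable (eps 1%N @^-1` B) by exact: disc_rv_preimage (disc_rv_eps 0).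
  apply: measure_negligible => //.
  have -> : eps 1%N @^-1` [set m | m != 0%N] =
      \bigcup_m (eps 1%N @^-1` [set k | k = m /\ k != 0%N]).
    by apply/seteqP; split=> [w /= ew|w [m _ []//]]; exists (eps 1%N w).
  apply: negligible_bigcup => m; have [->|m0] := eqVneq m 0%N.
    apply: negligibleS (negligible_set0 P) => w /= [->].
    by rewrite eqxx.
  apply: (@negligibleS _ _ _ _ (eps 1%N @^-1` [set m])); first by move=> w [].
  apply/negligibleP; first exact: mE.
  by apply/eqP; rewrite -measure_le0 leNgt; apply/negP => Pm; apply: H; exists m.
pose ind (M : nat) := (fun n : nat => ((n == M)%:R : R)%:E).
have kern_ge0 j f : (forall n, (0 <= f n)%E) -> (0 <= kern j f)%E.
  by move=> f0; rewrite -(integral_step 0)//; apply: integral_ge0 => *; exact: f0.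
have kpos j : (0 < kern j (ind (m + j)%N))%E.
  elim: j => [|j IH] /=.
    rewrite addn0 (_ : (\int[P]_w _)%E = P (eps 1%N @^-1` [set m]))//.
    transitivity (\int[P]_w (\1_(eps 1%N @^-1` [set m]) w)%:E)%E.
      by apply: eq_integral => w _; rewrite /ind indicE; case: eqP => e;
        [rewrite mem_set|rewrite memNset].
    by rewrite integral_indic// ?setIT//; exact: (disc_rv_eps 0).
  apply: (@lt_le_trans _ _ (alpha%:E * kern j (ind (m + j)%N))%E); first exact: mule_gt0.
  rewrite (_ : ind (m + j.+1)%N \o succn = ind (m + j)%N); last first.
    by apply/funext => n; rewrite /ind /= addnS eqSS.
  rewrite leeDl// mule_ge0//; first by rewrite lee_fin subr_ge0 ltW.
  by apply: kern_ge0 => n; rewrite lee_fin.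
have m1 (f : nat -> \bar R) : measurable_fun setT (fun w => f (inar_step 1 N w)).
  exact: disc_rv_measurable (disc_rv_step 0 N).
set q := (\int[P]_w _)%E.
have q0 : (0 < q)%E.
  apply: lt_le_trans (kpos N) _; rewrite -(integral_step 0); last by move=> n; rewrite lee_fin.
  apply: ge0_le_integral.
  - exact: measurableT.
  - by move=> w _; rewrite lee_fin.
  - exact: (m1 (ind (m + N)%N)).
  - exact: (m1 (fun n => (((n != N)%:R : R))%:E)).
  move=> w _; rewrite lee_fin ler_nat; case: eqP => //= ->.
  by rewrite -[X in _ != X]add0n eqn_add2r m0.
have q1 : (q <= 1)%E.
  apply: (@le_trans _ _ (\int[P]_w cst 1 w)%E).
    apply: ge0_le_integral => //.
    - exact: (m1 (fun n => (((n != N)%:R : R))%:E)).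
    by move=> w _; rewrite lee_fin lern1; case: (_ != _).
  by rewrite integral_cst//= probability_setT mule1.
have qE : q = (fine q)%:E.
  by rewrite fineK// ge0_fin_numE ?ltW//; apply: le_lt_trans q1 _; rewrite ltry.
by exists (fine q); split=> //; rewrite -!lte_fin -lee_fin -qE q0 q1.
Qed.

Lemma ae_visits_lt (N : nat) : exists p : R, 0 < p <= 1 /\
  {ae P, forall w, exists m0, forall m, (m0 <= m)%N -> forall k, (k <= 16 ^ m)%N ->
    `|mart (fun h y => if head 0%N h == N then (y != N)%:R - p else 0)
       (inar_hist k w)| < 12 ^+ m}.
Proof.
have [p [/andP[p0 p1] pE]] := step_leaves N.
exists p; split; first by rewrite p0.
pose D (h : seq nat) y : R := if head 0%N h == N then (y != N)%:R - p else 0.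
have mD h : measurable_fun setT (fun w => D h (inar_step 1 (head 0%N h) w)).
  exact: disc_rv_measurable (disc_rv_step 0 (head 0%N h)).
have D1 h y : `|D h y| <= 1.
  rewrite /D; case: ifP => _; last by rewrite normr0.
  by rewrite ler_norml; case: (y != N) => /=; apply/andP; split; lra.
have iD h : P.-integrable setT (fun w => (D h (inar_step 1 (head 0%N h) w))%:E).
  apply: (@le_integrable _ _ _ _ _ measurableT _ (cst 1%E)).
  - exact/measurable_EFinP.
  - by move=> w _; rewrite /= normr1 lee_fin; exact: D1.
  - exact: finite_measure_integrable_cst.
apply: (@ae_mart_lt (fun=> D) (fun _ _ => 1) 1) => //.
- move=> m h; rewrite /D; case: eqP => [->|_]; last by rewrite integral0.
  under eq_integral do rewrite EFinB.
  rewrite integralB//.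
  + by rewrite pE integral_cst//= probability_setT mule1 subee.
  (* At the trajectory [[:: N]] the increment is the indicator of a departure minus [p]; adding [p]
     back makes the indicator integrable. *)
  + have := iD [:: N]; rewrite /D /= eqxx => H.
    have := integrableD measurableT H (finite_measure_integrable_cst P p measurableT).
    by apply: eq_integrable => // w _; rewrite /= -EFinD subrK.
  + exact: finite_measure_integrable_cst.
- move=> m h; apply: (@le_trans _ _ (\int[P]_w cst 1 w)%E).
    apply: ge0_le_integral => //.
    + by move=> w _; rewrite lee_fin sqr_ge0.
    + exact: (disc_rv_measurable (fun y => (D h y ^+ 2)%:E) (disc_rv_step 0 (head 0%N h))).
    by move=> w _; rewrite lee_fin -real_normK ?num_real// expr_le1.
  by rewrite integral_cst//= probability_setT mule1.
- move=> m k; rewrite integral_cst//= probability_setT mule1 mul1r lee_fin.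
  by rewrite exprn_ege1// ler1n.
Qed.

(** These four facts are all that the least squares analysis takes from probability; that analysis
    then works path by path. *)
Lemma ae_inar_limits : {ae P, forall w, let x k := (X k w)%:R : R in
  [/\ (fun n => (\sum_(1 <= k < n.+1) (x k - (alpha * x k.-1 + mu))) / n%:R) @ \oo --> (0 : R),
      (fun n => (\sum_(1 <= k < n.+1) x k.-1 * (x k - (alpha * x k.-1 + mu))) / n%:R)
        @ \oo --> (0 : R),
      exists2 delta, 0 < delta & \forall n \near \oo,
        delta * n%:R <= \sum_(1 <= k < n.+1) (x k.-1 - mu / (1 - alpha)) ^+ 2 &
      (fun n => x n / n%:R) @ \oo --> (0 : R)]}.
Proof.
have /andP[a0 a1] := alpha01.
have mu0 : 0 <= mu.
  by rewrite -lee_fin -eps_mean; apply: integral_ge0 => w _; rewrite lee_fin.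
set c := mu / (1 - alpha).
have c0 : 0 <= c by apply: divr_ge0 => //; lra.
(* The integer closest to [c]: every other integer is at distance at least 1/2 from [c]. *)
pose N := Num.truncn (c + 1 / 2).
have Nc y : y != N -> 1 / 4 <= (y%:R - c) ^+ 2.
  have /andP[N1 N2] : N%:R <= c + 1 / 2 < N.+1%:R by apply: truncn_itv; lra.
  rewrite neq_ltn => /orP[yN|yN].
    have : (y.+1%:R <= N%:R :> R) by rewrite ler_nat.
    by rewrite -natr1 => H; nra.
  have : (N.+1%:R <= y%:R :> R) by rewrite ler_nat.
  by move=> H; nra.
have [p [p01 A3]] := ae_visits_lt N.
(* One power of the state is bounded by the truncation level [8 ^+ m], which is exactly the growth
   that [ae_weighted_mart_lt] allows. *)
have g2 m h : ((if head 0%N h <= 8 ^ m then head 0%N h else 0)%N%:R : R) ^+ 2 *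
    (alpha * (1 - alpha) * (head 0%N h)%:R + sigma2) <=
    8 ^+ m * (1 + sigma2) * (((head 0%N h)%:R) ^+ 2 + 1).
  have := sigma2_ge0; move: (sigma2) => v v0.
  have e0 : 1 <= 8 ^+ m :> R by rewrite exprn_ege1// ler1n.
  have x0 : 0 <= (head 0%N h)%:R :> R by [].
  have aa : alpha * (1 - alpha) <= 1 by nra.
  have aa0 : 0 <= alpha * (1 - alpha) by nra.
  case: ifP => [xm|_]; last first.
    rewrite expr0n mul0r; apply: mulr_ge0; first by apply: mulr_ge0; lra.
    by rewrite addr_ge0// sqr_ge0.
  have {}xm : (head 0%N h)%:R <= 8 ^+ m :> R by rewrite -natrX ler_nat.
  move: (head 0%N h)%:R xm x0 => x xm x0.
  have H1 : alpha * (1 - alpha) * x + v <= 8 ^+ m * (1 + v).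
    have : alpha * (1 - alpha) * x <= 8 ^+ m by apply: le_trans xm; rewrite ler_piMl.
    have : v <= 8 ^+ m * v by rewrite ler_peMl.
    by move=> *; lra.
  rewrite mulrC; apply: ler_pM => //.
  - by rewrite addr_ge0// mulr_ge0.
  - exact: sqr_ge0.
  - by lra.
have g1 m (h : seq nat) : (1 : R) ^+ 2 * (alpha * (1 - alpha) * (head 0%N h)%:R + sigma2) <=
    8 ^+ m * (1 + sigma2) * (((head 0%N h)%:R) ^+ 2 + 1).
  have := sigma2_ge0; move: (sigma2) => v v0.
  have e0 : 1 <= 8 ^+ m :> R by rewrite exprn_ege1// ler1n.
  have x0 : 0 <= (head 0%N h)%:R :> R by [].
  have xx : (head 0%N h)%:R <= (head 0%N h)%:R ^+ 2 :> R.
    by rewrite -natrX ler_nat; case: (head 0%N h) => // n; rewrite leq_pmulr.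
  have aa : alpha * (1 - alpha) <= 1 by nra.
  have aa0 : 0 <= alpha * (1 - alpha) by nra.
  rewrite expr1n mul1r -[leRHS]mulrA.
  move: (head 0%N h)%:R xx x0 => x xx x0.
  apply: (@le_trans _ _ ((1 + v) * (x ^+ 2 + 1))).
    have : alpha * (1 - alpha) * x <= x by rewrite ler_piMl.
    have : 0 <= v * x ^+ 2 by rewrite mulr_ge0// sqr_ge0.
    by move=> *; lra.
  by rewrite ler_peMl// mulr_ge0//; nra.
have sigma21 : 0 <= 1 + sigma2 by rewrite addr_ge0.
have A1 := ae_weighted_mart_lt sigma21 g1.
have A2 := ae_weighted_mart_lt sigma21 g2.
apply: filterS (filterI (filterI A1 A2) (filterI A3 ae_X_le)).
move=> w [[[m1 H1] [m2 H2]] [[m3 H3] [m4 H4]]] x.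
split.
- apply: cvg_div_of_blocks; exists m1 => m mm n nm.
  apply: ltW; have := H1 m mm n nm; rewrite mart_hist.
  congr (`|_| < _); apply: eq_big_nat => k /andP[k1 _].
  by rewrite head_hist mul1r.
(* From block [m4] on, the states of a block stay below [8 ^ m], so the truncated weight is the
   state itself. *)
- apply: cvg_div_of_blocks; exists (maxn m2 m4) => m; rewrite geq_max => /andP[mm2 mm4] n nm.
  apply: ltW; have := H2 m mm2 n nm; rewrite mart_hist.
  congr (`|_| < _); apply: eq_big_nat => k /andP[k1 kn].
  rewrite head_hist H4//; apply: leq_trans nm; exact: leq_trans (leq_pred k) _.
- have /andP[p0 p1] := p01.
  exists (p / 32); first by rewrite divr_gt0.
  apply: (@visits_lower (X^~ w) _ _ _ p01 Nc); apply: cvg_div_of_blocks; exists m3 => m mm n nm.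
  apply: ltW; have := H3 m mm n nm; rewrite mart_hist.
  congr (`|_| < _); apply: eq_big_nat => k /andP[k1 _].
  by rewrite head_hist.
- apply: cvg_div_of_blocks; exists m4 => m mm n nm.
  rewrite /x normr_nat; apply: (@le_trans _ _ (8 ^+ m)).
    by rewrite -natrX ler_nat H4.
  by apply: lerXn2r; rewrite ?nnegrE// ler_nat.
Qed.

End INAR.

(** * Existence, location and uniqueness of minimizers for fixed coefficients *)

Section ConditionalLeastSquares.
Variable R : realType.

Lemma continuous_coercive_min (f : R -> R -> R -> R) (a0 m0 t0 rho : R) :
  continuous (fun z : R * R * R => f z.1.1 z.1.2 z.2) ->
  (forall a m t, f a m t <= f a0 m0 t0 -> [/\ `|a| <= rho, `|m| <= rho & `|t| <= rho]) ->
  exists a m t, is_global_minimizer f a m t.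
Proof.
move=> fc frho.
pose box : set (R * R * R) := (`[- rho, rho] `*` `[- rho, rho]) `*` `[- rho, rho].
have inbox a m t : [/\ `|a| <= rho, `|m| <= rho & `|t| <= rho] -> box (a, m, t).
  by case; rewrite /box !ler_norml /= !in_itv /=.
have box0 : box (a0, m0, t0) by apply: inbox; exact: frho.
have cbox : compact box.
  apply: compact_setX; last exact: segment_compact.
  by apply: compact_setX; exact: segment_compact.
have [||[[a m] t] _ fmin] := @compact_EVT_min _ R (fun z => f z.1.1 z.1.2 z.2) box _ cbox.
- by exists (a0, m0, t0).
- exact: continuous_subspaceT.
exists a, m, t => a' m' t'.
have [le0|/ltW gt0] := leP (f a' m' t') (f a0 m0 t0).
  by apply: (fmin (a', m', t')); rewrite inE; apply: inbox; exact: frho.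
by apply: le_trans gt0; apply: (fmin (a0, m0, t0)); rewrite inE.
Qed.

(* The objective in the coordinates [a - alpha] and [m - mu + (a - alpha) c],
   the last one orthogonalising the regression when [c] is the stationary mean. *)
Variables (V W U A B N y0 y1 y2 alpha mu c : R).

Let b a m := m - mu + (a - alpha) * c.
Definition cls a m t :=
  V - 2 * (a - alpha) * W - 2 * b a m * U
  + ((a - alpha) ^+ 2 * B + 2 * (a - alpha) * b a m * A + b a m ^+ 2 * N)
  + (y1 - a * y0 - m - t) ^+ 2 + (y2 - a * y1 - m + a * t) ^+ 2.

Lemma cls_continuous : continuous (fun z : R * R * R => cls z.1.1 z.1.2 z.2).
Proof.
have ca : continuous (fun z : R * R * R => z.1.1).
  by move=> z; apply: (@continuous_comp _ _ _ fst fst); exact: cvg_fst.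
have cm : continuous (fun z : R * R * R => z.1.2).
  by move=> z; apply: (@continuous_comp _ _ _ fst snd); [exact: cvg_fst|exact: cvg_snd].
have ct : continuous (fun z : R * R * R => z.2).
  by move=> z; exact: cvg_snd.
have cc (k : R) : continuous (fun _ : R * R * R => k) by move=> z; exact: cvg_cst.
have cD (f g : R * R * R -> R) : continuous f -> continuous g ->
    continuous (fun z => f z + g z) by move=> cf cg z; exact: cvgD (cf z) (cg z).
have cN (f : R * R * R -> R) : continuous f -> continuous (fun z => - f z).
  by move=> cf z; exact: cvgN (cf z).
have cM (f g : R * R * R -> R) : continuous f -> continuous g ->
    continuous (fun z => f z * g z) by move=> cf cg z; exact: cvgM (cf z) (cg z).
have cX (f : R * R * R -> R) : continuous f -> continuous (fun z => f z ^+ 2).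
  by move=> cf; under eq_fun do rewrite expr2; exact: cM.
have cda := cD _ _ ca (cc (- alpha)).
have cb := cD _ _ (cD _ _ cm (cc (- mu))) (cM _ _ cda (cc c)).
have cr1 := cD _ _ (cD _ _ (cD _ _ (cc y1) (cN _ (cM _ _ ca (cc y0)))) (cN _ cm)) (cN _ ct).
have cr2 := cD _ _ (cD _ _ (cD _ _ (cc y2) (cN _ (cM _ _ ca (cc y1)))) (cN _ cm)) (cM _ _ ca ct).
have clin := cD _ _ (cD _ _ (cc V) (cN _ (cM _ _ (cM _ _ (cc 2) cda) (cc W))))
  (cN _ (cM _ _ (cM _ _ (cc 2) cb) (cc U))).
have cquad := cD _ _ (cD _ _ (cM _ _ (cX _ cda) (cc B))
  (cM _ _ (cM _ _ (cM _ _ (cc 2) cda) cb) (cc A))) (cM _ _ (cX _ cb) (cc N)).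
exact: (cD _ _ (cD _ _ (cD _ _ clin cquad) (cX _ cr1)) (cX _ cr2)).
Qed.

(** [E] stands for the sample size, [kappa] for the curvature per observation, and [e] for the small
    relative size of the gradient and of the off-diagonal coefficient. *)
Variables (kappa e E : R).
Hypotheses (kappa0 : 0 < kappa) (E0 : 0 < E) (e0 : 0 <= e) (ek : e <= kappa / 2).
Hypotheses (BE : kappa * E <= B) (NE : kappa * E <= N).
Hypotheses (AE : `|A| <= e * E) (UE : `|U| <= e * E) (WE : `|W| <= e * E).

(** The off-diagonal term is at most [e * E * (u ^+ 2 + v ^+ 2)], and [e <= kappa / 2] lets half of
    the diagonal absorb it. *)
Lemma quad_lower (u v : R) :
  kappa / 2 * E * (u ^+ 2 + v ^+ 2) <= u ^+ 2 * B + 2 * u * v * A + v ^+ 2 * N.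
Proof.
have H1 : u ^+ 2 * (kappa * E) <= u ^+ 2 * B by rewrite ler_wpM2l// sqr_ge0.
have H2 : v ^+ 2 * (kappa * E) <= v ^+ 2 * N by rewrite ler_wpM2l// sqr_ge0.
have H3 : - (kappa / 2 * E * (u ^+ 2 + v ^+ 2)) <= 2 * u * v * A.
  have : `|2 * u * v * A| <= (u ^+ 2 + v ^+ 2) * (e * E).
    rewrite normrM; apply: ler_pM => //.
    by rewrite ler_norml; apply/andP; split; have := sqr_ge0 (u + v); have := sqr_ge0 (u - v); nra.
  rewrite ler_norml => /andP[H _]; apply: le_trans H.
  rewrite lerN2 mulrC ler_wpM2r ?addr_ge0 ?sqr_ge0//.
  by rewrite ler_wpM2r// ltW.
lra.
Qed.

(** The two outlier squares at the true [alpha] and [mu] with outlier size 0, the competitor used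
    against every minimizer. *)
Let C0 := (y1 - alpha * y0 - mu) ^+ 2 + (y2 - alpha * y1 - mu) ^+ 2.

Lemma cls_true : cls alpha mu 0 = V + C0.
Proof. by rewrite /cls /b /C0; ring. Qed.

(** Young's inequality: each linear term costs a quarter of [kappa * E] in its own variable plus
    [4 * e ^+ 2 * E / kappa], which leaves a quarter of the curvature. *)
Lemma cls_sublevel a m t : cls a m t <= V + C0 ->
  kappa / 4 * E * ((a - alpha) ^+ 2 + b a m ^+ 2) + (y1 - a * y0 - m - t) ^+ 2
    <= 8 * e ^+ 2 * E / kappa + C0.
Proof.
rewrite /cls => H.
have := quad_lower (a - alpha) (b a m).
have lin u Z : `|Z| <= e * E -> 2 * u * Z <= kappa / 4 * E * u ^+ 2 + 4 * e ^+ 2 * E / kappa.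
  move=> ZE; apply: (@le_trans _ _ (2 * `|u| * (e * E))).
    apply: le_trans (ler_norm _) _; rewrite !normrM (ger0_norm (ler0n R 2)).
    by rewrite ler_wpM2l// mulr_ge0.
  rewrite -subr_ge0 -(real_normK (num_real u)).
  have -> : kappa / 4 * E * `|u| ^+ 2 + 4 * e ^+ 2 * E / kappa - 2 * `|u| * (e * E) =
      E / (4 * kappa) * (kappa * `|u| - 4 * e) ^+ 2.
    by field; exact: lt0r_neq0.
  by rewrite mulr_ge0 ?sqr_ge0// divr_ge0// ltW// mulr_gt0.
have := lin (a - alpha) W WE; have := lin (b a m) U UE.
have := sqr_ge0 (y2 - a * y1 - m + a * t).
move: H; move: (b a m) => v.
have -> : 8 * e ^+ 2 * E / kappa = 4 * e ^+ 2 * E / kappa + 4 * e ^+ 2 * E / kappa by ring.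
lra.
Qed.

(** The sublevel set of the competitor is bounded: the curvature controls [a] and [m], and the first
    outlier square then controls [t]. *)
Lemma cls_min_exists : exists a m t, is_global_minimizer cls a m t.
Proof.
pose K := 8 * e ^+ 2 * E / kappa + C0.
have K0 : 0 <= K.
  apply: addr_ge0; last by rewrite addr_ge0// sqr_ge0.
  by rewrite divr_ge0 ?(ltW kappa0)// !mulr_ge0 ?sqr_ge0// ltW.
have sqb (u L : R) : 0 <= L -> u ^+ 2 <= L -> `|u| <= L + 1.
  by move=> L0 uL; rewrite ler_norml; apply/andP; split; nra.
pose L := K / (kappa / 4 * E).
have kE : 0 < kappa / 4 * E by rewrite mulr_gt0// divr_gt0.
have L0 : 0 <= L by rewrite divr_ge0// ltW.
pose ra := `|alpha| + (L + 1).
pose rm := `|mu| + (L + 1) + (L + 1) * `|c|.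
pose rt := `|y1| + ra * `|y0| + rm + (K + 1).
have ra0 : 0 <= ra by rewrite !addr_ge0.
have rm0 : 0 <= rm by rewrite !addr_ge0// mulr_ge0// addr_ge0.
have rt0 : 0 <= rt.
  by apply: addr_ge0 (addr_ge0 K0 ler01); apply: addr_ge0 rm0; apply: addr_ge0 (mulr_ge0 ra0 _).
apply: (continuous_coercive_min (a0 := alpha) (m0 := mu) (t0 := 0) (rho := ra + rm + rt)
  cls_continuous) => a m t.
rewrite cls_true => /cls_sublevel; rewrite -/K => H.
have sq0 := sqr_ge0 (y1 - a * y0 - m - t).
have Ha : (a - alpha) ^+ 2 <= L.
  rewrite ler_pdivlMr// mulrC; have := sqr_ge0 (b a m); nra.
have Hb : b a m ^+ 2 <= L.
  rewrite ler_pdivlMr// mulrC; have := sqr_ge0 (a - alpha); nra.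
have Ht : (y1 - a * y0 - m - t) ^+ 2 <= K.
  apply: le_trans H; rewrite lerDr mulr_ge0 ?addr_ge0 ?sqr_ge0//; exact: ltW.
have {}Ha := sqb _ _ L0 Ha; have {}Hb := sqb _ _ L0 Hb; have {}Ht := sqb _ _ K0 Ht.
have Ba : `|a| <= ra.
  rewrite -(subrK alpha a) addrC; apply: le_trans (ler_normD _ _) _; exact: lerD.
have Bm : `|m| <= rm.
  rewrite (_ : m = mu + b a m - (a - alpha) * c); last by rewrite /b; ring.
  apply: le_trans (ler_normB _ _) _; rewrite normrM; apply: lerD.
    by apply: le_trans (ler_normD _ _) _; exact: lerD.
  by rewrite ler_wpM2r.
have Bt : `|t| <= rt.
  rewrite (_ : t = y1 - a * y0 - m - (y1 - a * y0 - m - t)); last by ring.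
  apply: le_trans (ler_normB _ _) _; apply: lerD => //.
  apply: le_trans (ler_normB _ _) _; apply: lerD => //.
  by apply: le_trans (ler_normB _ _) _; rewrite normrM; apply: lerD => //; rewrite ler_wpM2r.
by split; lra.
Qed.

(** For fixed [a] and [m] the objective is a quadratic in [t] with leading coefficient [1 + a ^+ 2];
    the right side is its vertex. *)
Lemma cls_min_t a m t : is_global_minimizer cls a m t ->
  t = (y1 - a * y0 - m - a * (y2 - a * y1 - m)) / (1 + a ^+ 2).
Proof.
have a2 : 0 < 1 + a ^+ 2 by rewrite ltr_wpDr// sqr_ge0.
set t' := _ / _ => /(_ a m t').
have tE : t' * (1 + a ^+ 2) = y1 - a * y0 - m - a * (y2 - a * y1 - m).
  by rewrite /t' divfK// lt0r_neq0.
rewrite /cls => H; apply/eqP; rewrite -subr_eq0 -sqrf_eq0.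
have : (1 + a ^+ 2) * (t - t') ^+ 2 <= 0.
  move: H; clearbody t'; move: (b a m) => v H.
  have -> : (1 + a ^+ 2) * (t - t') ^+ 2 =
      (y1 - a * y0 - m - t) ^+ 2 + (y2 - a * y1 - m + a * t) ^+ 2 -
      ((y1 - a * y0 - m - t') ^+ 2 + (y2 - a * y1 - m + a * t') ^+ 2)
      - 2 * (t - t') * (t' * (1 + a ^+ 2) - (y1 - a * y0 - m - a * (y2 - a * y1 - m))) by ring.
  by rewrite tE subrr mulr0 subr0; lra.
by rewrite pmulr_rle0// => H'; rewrite eq_le H' sqr_ge0.
Qed.

(** The bound vanishes as [e] tends to 0 and [E] to infinity, which gives consistency. *)
Lemma cls_min_near a m t : is_global_minimizer cls a m t ->
  (a - alpha) ^+ 2 + b a m ^+ 2 <= 32 * e ^+ 2 / kappa ^+ 2 + 4 * C0 / (kappa * E).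
Proof.
move=> /(_ alpha mu 0); rewrite cls_true => /cls_sublevel H.
have kE : 0 < kappa / 4 * E by rewrite mulr_gt0// divr_gt0.
rewrite -(ler_pM2l kE).
have -> : kappa / 4 * E * (32 * e ^+ 2 / kappa ^+ 2 + 4 * C0 / (kappa * E)) =
    8 * e ^+ 2 * E / kappa + C0.
  by field; rewrite !lt0r_neq0.
have := sqr_ge0 (y1 - a * y0 - m - t); lra.
Qed.

(* The objective is convex up to the bilinear term [a * t], whose defect at the midpoint of
   two minimizers is dominated by the curvature [kappa * E]. *)
Lemma cls_min_unique (T Rb : R) a m t a' m' t' :
  is_global_minimizer cls a m t -> is_global_minimizer cls a' m' t' ->
  `|t - t'| <= T ->
  `|(y2 - a * y1 - m + a * t) + (y2 - a' * y1 - m' + a' * t')| <= 2 * Rb ->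
  1 + (y0 - c) ^+ 2 + Rb ^+ 2 + T ^+ 2 < kappa / 8 * E ->
  [/\ a = a', m = m' & t = t'].
Proof.
move=> min1 min2 tT rR Elarge.
set r := _ + _ in rR.
have Hmid := min1 ((a + a') / 2) ((m + m') / 2) ((t + t') / 2).
have Hmid' := min2 ((a + a') / 2) ((m + m') / 2) ((t + t') / 2).
pose da := a - a'; pose db := b a m - b a' m'; pose dt := t - t'.
have quad := quad_lower da db.
have bm : b ((a + a') / 2) ((m + m') / 2) = (b a m + b a' m') / 2 by rewrite /b; field.
have dm : m - m' = db - da * c by rewrite /db /da /b; ring.
(* Parallelogram identities at the midpoint. The average of the two products [a * t] exceeds the
   product at the midpoint by [da * dt / 4], which produces the right side. *)
have key : 1 / 4 * (da ^+ 2 * B + 2 * da * db * A + db ^+ 2 * N) +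
    1 / 4 * (da * y0 + (m - m') + dt) ^+ 2 <= - (r * da * dt / 4) + (da * dt / 4) ^+ 2.
  have H : cls a m t + cls a' m' t' <=
    2 * cls ((a + a') / 2) ((m + m') / 2) ((t + t') / 2) by lra.
  have D1 : 0 <= (- da * y1 - (m - m') + (a * t - a' * t')) ^+ 2 by exact: sqr_ge0.
  move: H; rewrite /cls bm /r /db /da /dt in D1 *.
  move: (b a m) (b a' m') => v v'; lra.
have P1 : 1 / 4 * (da * y0 + (m - m') + dt) ^+ 2 >=
    dt ^+ 2 / 8 - 1 / 2 * (da ^+ 2 * (y0 - c) ^+ 2 + db ^+ 2).
  rewrite dm.
  have := sqr_ge0 (dt + 2 * (da * (y0 - c) + db)).
  have := sqr_ge0 (da * (y0 - c) - db); lra.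
have P2 : - (r * da * dt / 4) <= dt ^+ 2 / 16 + Rb ^+ 2 * da ^+ 2.
  have r2 : r ^+ 2 <= 4 * Rb ^+ 2.
    have -> : 4 * Rb ^+ 2 = (2 * Rb) ^+ 2 by ring.
    by rewrite -(real_normK (num_real r)); apply: lerXn2r; rewrite ?nnegrE//; apply: le_trans rR.
  have : r ^+ 2 * da ^+ 2 <= 4 * Rb ^+ 2 * da ^+ 2 by rewrite ler_wpM2r// sqr_ge0.
  have := sqr_ge0 (dt / 4 + r * da / 2); lra.
have P3 : (da * dt / 4) ^+ 2 <= T ^+ 2 * da ^+ 2.
  have t2 : dt ^+ 2 <= T ^+ 2.
    by rewrite -(real_normK (num_real dt)); apply: lerXn2r; rewrite ?nnegrE//; apply: le_trans tT.
  have : dt ^+ 2 * da ^+ 2 <= T ^+ 2 * da ^+ 2 by rewrite ler_wpM2r// sqr_ge0.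
  have := mulr_ge0 (sqr_ge0 dt) (sqr_ge0 da); lra.
(* Of [dt ^+ 2 / 8] from [P1], one half pays for the residual term in [P2]. Everything else is a
   multiple of [da ^+ 2] or [db ^+ 2], covered by the curvature [kappa / 8 * E]. *)
have tot : (kappa / 8 * E - (1 + (y0 - c) ^+ 2 + Rb ^+ 2 + T ^+ 2)) * (da ^+ 2 + db ^+ 2)
    + dt ^+ 2 / 16 <= 0.
  have h1 := sqr_ge0 da; have h2 := sqr_ge0 db.
  have h3 := mulr_ge0 (sqr_ge0 (y0 - c)) h1; have h4 := mulr_ge0 (sqr_ge0 (y0 - c)) h2.
  have h5 := mulr_ge0 (sqr_ge0 Rb) h2; have h6 := mulr_ge0 (sqr_ge0 T) h2; lra.
set G := _ - _ in tot.
have G0 : 0 < G by rewrite subr_gt0.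
have h1 := sqr_ge0 da; have h2 := sqr_ge0 db; have h3 := sqr_ge0 dt.
have hG : 0 <= G * (da ^+ 2 + db ^+ 2) by apply: mulr_ge0; [exact: ltW|exact: addr_ge0].
have dt0 : dt = 0 by apply/eqP; rewrite -sqrf_eq0; apply/eqP; lra.
have : G * (da ^+ 2 + db ^+ 2) <= 0 by lra.
rewrite pmulr_rle0// => hs.
have da0 : da = 0 by apply/eqP; rewrite -sqrf_eq0; apply/eqP; lra.
have db0 : db = 0 by apply/eqP; rewrite -sqrf_eq0; apply/eqP; lra.
split; apply/eqP; rewrite -subr_eq0; apply/eqP => //.
by rewrite dm db0 da0 mul0r subr0.
Qed.

End ConditionalLeastSquares.

(** * Asymptotics of the minimizers along a fixed path *)

Section DeterministicLimit.
Variable R : realType.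

Lemma near_infty_natr_ge (k : R) : \forall n \near \oo, k <= n%:R.
Proof. exact: nbhs_infty_ger. Qed.

Lemma near_le_of_cvg_div0 (f : nat -> R) (e : R) : 0 < e ->
  (fun n => f n / n%:R) @ \oo --> (0 : R) -> \forall n \near \oo, `|f n| <= e * n%:R.
Proof.
move=> e0 /cvgrPdist_le /(_ e e0) H.
apply: filterS (filterI H (near_infty_natr_ge 1)) => n [].
rewrite sub0r normrN => fn n1; have n0 : 0 < n%:R :> R by lra.
by move: fn; rewrite normrM normfV (gtr0_norm n0) ler_pdivrMr.
Qed.

Lemma cvg_div0_of_near_le (f : nat -> R) :
  (forall e, 0 < e -> \forall n \near \oo, `|f n| <= e * n%:R) ->
  (fun n => f n / n%:R) @ \oo --> (0 : R).
Proof.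
move=> H; apply/cvgrPdist_le => e e0.
apply: filterS (filterI (H e e0) (near_infty_natr_ge 1)) => n [fn n1].
have n0 : 0 < n%:R :> R by lra.
by rewrite sub0r normrN normrM normfV (gtr0_norm n0) ler_pdivrMr.
Qed.

Lemma near_const_le (k e : R) : 0 < e -> \forall n \near \oo, k <= e * n%:R.
Proof.
move=> e0; apply: filterS (near_infty_natr_ge (k / e)) => n.
by rewrite ler_pdivrMr// mulrC.
Qed.

Variables (x : nat -> R) (alpha mu theta : R) (s : nat).
Hypotheses (alpha01 : 0 < alpha < 1) (s0 : (0 < s)%N).
Let y k := x k + (if k == s then theta else 0).
Let c := mu / (1 - alpha).
Let z k := x k - c.
Let M k := x k - (alpha * x k.-1 + mu).
Let KS (f : nat -> R) n := \sum_(1 <= k < n.+1 | (k != s) && (k != s.+1)) f k.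

Lemma sum_excl (f : nat -> R) n : (s < n)%N ->
  \sum_(1 <= k < n.+1) f k = KS f n + (f s + f s.+1).
Proof.
move=> sn; rewrite (bigID (fun k => k == s)) big_nat1_eq s0 ltnS ltnW//=.
rewrite (bigID (fun k => k == s.+1)) /= [X in _ + (X + _)](_ : _ = f s.+1).
  by rewrite addrA addrC.
rewrite (eq_bigl (fun k => k == s.+1)).
  by rewrite big_nat1_eq /= ltnS sn.
by move=> k; case: (k =P s.+1) => [->|_]; rewrite ?andbF//= andbT gtn_eqF.
Qed.

(** Away from [s] and [s.+1] the observations are those of [x], and the residual is
    [M k - (a - alpha) * z k.-1 - b] with [b = m - mu + (a - alpha) * c]; expanding its square gives
    the coefficients. *)
Lemma Qn_cls n a m t : (s < n)%N ->
  Qn y s n a m t = cls (KS (fun k => M k ^+ 2) n) (KS (fun k => z k.-1 * M k) n) (KS M n)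
    (KS (fun k => z k.-1) n) (KS (fun k => z k.-1 ^+ 2) n) (KS (fun=> 1) n)
    (y s.-1) (y s) (y s.+1) alpha mu c a m t.
Proof.
move=> sn; have /andP[a0 a1] := alpha01.
rewrite /Qn /cls; congr (_ + _ + _).
rewrite /KS !mulr_sumr -!sumrN -!big_split /=.
rewrite big_nat_cond [RHS]big_nat_cond; apply: eq_bigr => k /andP[/andP[k1 kn] /andP[ks ks1]].
have -> : y k = x k by rewrite /y (negPf ks) addr0.
have -> : y k.-1 = x k.-1.
  rewrite /y ifF ?addr0//; apply/negP => /eqP e; move: ks1.
  by rewrite -e prednK// eqxx.
rewrite /M /z; ring.
Qed.

Lemma cvg_excl (f : nat -> R) :
  (fun n => (\sum_(1 <= k < n.+1) f k) / n%:R) @ \oo --> (0 : R) ->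
  (fun n => KS f n / n%:R) @ \oo --> (0 : R).
Proof.
move=> H; apply: cvg_div0_of_near_le => e e0.
have e2 : 0 < e / 2 by rewrite divr_gt0.
have h1 := near_le_of_cvg_div0 e2 H.
have h2 := near_const_le `|f s + f s.+1| e2.
apply: filterS (filterI (filterI h1 h2) (nbhs_infty_gt s)) => n [[H1 H2] sn].
rewrite sum_excl// in H1.
rewrite -[KS f n](addrK (f s + f s.+1)); apply: le_trans (ler_normB _ _) _; lra.
Qed.

Hypothesis cvg_sumM : (fun n => (\sum_(1 <= k < n.+1) M k) / n%:R) @ \oo --> (0 : R).
Hypothesis cvg_sumxM : (fun n => (\sum_(1 <= k < n.+1) x k.-1 * M k) / n%:R) @ \oo --> (0 : R).
Hypothesis var_lower : exists2 delta, 0 < delta & \forall n \near \oo,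
  delta * n%:R <= \sum_(1 <= k < n.+1) (x k.-1 - c) ^+ 2.
Hypothesis cvg_x : (fun n => x n / n%:R) @ \oo --> (0 : R).

Lemma cvg_excl_zM : (fun n => KS (fun k => z k.-1 * M k) n / n%:R) @ \oo --> (0 : R).
Proof.
apply: cvg_excl.
have -> : (fun n => (\sum_(1 <= k < n.+1) z k.-1 * M k) / n%:R) =
    (fun n => (\sum_(1 <= k < n.+1) x k.-1 * M k) / n%:R -
       c * ((\sum_(1 <= k < n.+1) M k) / n%:R)).
  apply/funext => n; rewrite mulrA -mulrBl mulr_sumr -sumrB; congr (_ / _).
  by apply: eq_bigr => k _; rewrite /z; ring.
rewrite -[X in _ --> X](_ : 0 - c * 0 = 0 :> R); last by rewrite mulr0 subr0.
apply: cvgB => //; apply: cvgM => //; exact: cvg_cst.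
Qed.

(** Since [M k = x k - x k.-1 + (1 - alpha) * z k.-1], telescoping expresses the sum of [z] through
    the sum of [M] and the two end values, all negligible against [n]. *)
Lemma cvg_excl_z : (fun n => KS (fun k => z k.-1) n / n%:R) @ \oo --> (0 : R).
Proof.
apply: cvg_excl; have /andP[a0 a1] := alpha01.
have a1' : 0 < 1 - alpha by lra.
apply: cvg_div0_of_near_le => e e0.
have e3 : 0 < e * (1 - alpha) / 3 by rewrite divr_gt0// mulr_gt0.
have h1 := near_le_of_cvg_div0 e3 cvg_sumM.
have h2 := near_le_of_cvg_div0 e3 cvg_x.
have h3 := near_const_le `|x 0%N| e3.
apply: filterS (filterI (filterI h1 h2) h3) => n [[H1 H2] H3].
have id : \sum_(1 <= k < n.+1) M k = x n - x 0%N + (1 - alpha) * \sum_(1 <= k < n.+1) z k.-1.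
  rewrite -(telescope_sumr x (leq0n n)) mulr_sumr.
  rewrite big_add1 [in RHS]big_add1 /= -big_split /=.
  by apply: eq_bigr => k _; rewrite /M /z /c /=; field; exact: lt0r_neq0.
rewrite -(ler_pM2l a1') -[X in X * `|_|](gtr0_norm a1') -normrM.
have -> : (1 - alpha) * \sum_(1 <= k < n.+1) z k.-1 = \sum_(1 <= k < n.+1) M k - x n + x 0%N.
  by rewrite id; ring.
apply: le_trans (ler_normD _ _) _; have := ler_normB (\sum_(1 <= k < n.+1) M k) (x n); lra.
Qed.

Let Fn n := cls (KS (fun k => M k ^+ 2) n) (KS (fun k => z k.-1 * M k) n) (KS M n)
    (KS (fun k => z k.-1) n) (KS (fun k => z k.-1 ^+ 2) n) (KS (fun=> 1) n)
    (y s.-1) (y s) (y s.+1) alpha mu c.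

Let good (kappa e : R) n := [/\ kappa * n%:R <= KS (fun k => z k.-1 ^+ 2) n,
  kappa * n%:R <= KS (fun=> 1) n, `|KS (fun k => z k.-1) n| <= e * n%:R,
  `|KS M n| <= e * n%:R & `|KS (fun k => z k.-1 * M k) n| <= e * n%:R].

(** The curvature [kappa] is fixed before [e], so [e] can later be chosen small relative to it. *)
Lemma near_good : exists2 kappa, 0 < kappa &
  forall e, 0 < e -> \forall n \near \oo, good kappa e n.
Proof.
have [delta d0 Hd] := var_lower.
pose kappa := Num.min (delta / 2) (1 / 2).
have k1 : kappa <= delta / 2 by rewrite ge_min lexx.
have k2 : kappa <= 1 / 2 by rewrite ge_min lexx orbT.
exists kappa; first by rewrite lt_min !divr_gt0.
move=> e e0.
have h1 := near_le_of_cvg_div0 e0 cvg_excl_z.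
have h2 := near_le_of_cvg_div0 e0 (cvg_excl cvg_sumM).
have h3 := near_le_of_cvg_div0 e0 cvg_excl_zM.
have h4 := near_const_le (z s.-1 ^+ 2 + z s ^+ 2) (divr_gt0 d0 (ltr0n R 2)).
have h5 := near_infty_natr_ge 4.
apply: filterS (filterI (filterI (filterI h1 h2) (filterI h3 h4))
  (filterI Hd (filterI h5 (nbhs_infty_gt s)))).
move=> n [[[H1 H2] [H3 H4]] [H5 [H6 sn]]]; split=> //.
  move: H5; rewrite (sum_excl (fun k => z k.-1 ^+ 2))// => H5.
  apply: (@le_trans _ _ (delta / 2 * n%:R)); first by rewrite ler_wpM2r.
  by rewrite /= in H5; lra.
have := sum_excl (fun=> 1 : R) sn; rewrite sumr_const_nat subn1 /= => H7.
apply: (@le_trans _ _ (1 / 2 * n%:R)); first by rewrite ler_wpM2r.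
lra.
Qed.

Let C0 := (y s - alpha * y s.-1 - mu) ^+ 2 + (y s.+1 - alpha * y s - mu) ^+ 2.

Lemma near_min_close (eta : R) : 0 < eta ->
  \forall n \near \oo, forall a m t, is_global_minimizer (Fn n) a m t ->
  (a - alpha) ^+ 2 + (m - mu + (a - alpha) * c) ^+ 2 <= eta.
Proof.
move=> eta0; have [kappa k0 H] := near_good.
(* With [v = Num.min eta 1] this makes [32 * e ^+ 2 / kappa ^+ 2] at most [v ^+ 2 / 2]; the cap at 1
   gives [v ^+ 2 <= eta]. *)
pose e := Num.min (kappa / 2) (kappa * Num.min eta 1 / 8).
have m0 : 0 < Num.min eta 1 by rewrite lt_min eta0 ltr01.
have e0 : 0 < e by rewrite lt_min !(divr_gt0, mulr_gt0).
have ek : e <= kappa / 2 by rewrite ge_min lexx.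
have e2 : 32 * e ^+ 2 / kappa ^+ 2 <= eta / 2.
  have em : e <= kappa * Num.min eta 1 / 8 by rewrite ge_min lexx orbT.
  have : e ^+ 2 <= (kappa * Num.min eta 1 / 8) ^+ 2
    by apply: lerXn2r; rewrite ?nnegrE// ltW// (lt_le_trans e0).
  have meta : Num.min eta 1 <= eta by rewrite ge_min lexx.
  have m1 : Num.min eta 1 <= 1 by rewrite ge_min lexx orbT.
  move: (Num.min eta 1) m0 meta m1 => v v0 veta v1 He.
  rewrite ler_pdivrMr ?exprn_gt0//.
  apply: (@le_trans _ _ (v ^+ 2 / 2 * kappa ^+ 2)); first by lra.
  by rewrite ler_wpM2r ?sqr_ge0//; nra.
have h2 := near_const_le (4 * C0) (mulr_gt0 k0 (divr_gt0 eta0 (ltr0n R 2))).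
apply: filterS (filterI (filterI (H e e0) h2) (near_infty_natr_ge 1)).
move=> n [[[H1 H2 H3 H4 H5] H6] H7] a m t Hmin.
have n0 : 0 < n%:R :> R by lra.
have /= := cls_min_near k0 n0 ek H1 H2 H3 H4 H5 Hmin.
rewrite -/C0.
have : 4 * C0 / (kappa * n%:R) <= eta / 2.
  by rewrite ler_pdivrMr ?mulr_gt0//; lra.
lra.
Qed.

Lemma near_unique_min : \forall n \near \oo, has_unique_global_minimizer (Fn n).
Proof.
have /andP[a0 a1] := alpha01.
have [kappa k0 Hgood] := near_good.
have Hclose := near_min_close.
(* Bounds independent of [n] for minimizers with [|a| <= 2]: on [m], on the two outlier residuals
   without their [t] terms, on [t], and on the full second residual. *)
pose Bm := `|mu| + 1 + `|c|.
pose Bp := `|y s| + 2 * `|y s.-1| + Bm.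
pose Bq := `|y s.+1| + 2 * `|y s| + Bm.
pose Bt := Bp + 2 * Bq.
pose Rb := Bq + 2 * Bt.
have k2 : 0 < kappa / 2 by rewrite divr_gt0.
have k8 : 0 < kappa / 8 by rewrite divr_gt0.
(* The 2, against the 1 in [cls_min_unique], turns a weak inequality into the strict one. *)
have h3 := near_const_le (2 + (y s.-1 - c) ^+ 2 + Rb ^+ 2 + (2 * Bt) ^+ 2) k8.
apply: filterS (filterI (filterI (Hgood _ k2) (Hclose 1 ltr01))
  (filterI h3 (near_infty_natr_ge 1))).
move=> n [[[H1 H2 H3 H4 H5] H6] [H7 H8]].
have n0 : 0 < n%:R :> R by lra.
have bounds a m t : is_global_minimizer (Fn n) a m t ->
    `|t| <= Bt /\ `|y s.+1 - a * y s - m + a * t| <= Rb.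
  move=> Hmin; have H := H6 a m t Hmin.
  have tE := cls_min_t Hmin.
  have sq1 (u : R) : u ^+ 2 <= 1 -> `|u| <= 1.
    by move=> u1; rewrite ler_norml; apply/andP; split; nra.
  have ha : `|a - alpha| <= 1.
    apply: sq1; have := sqr_ge0 (m - mu + (a - alpha) * c); lra.
  have hb : `|m - mu + (a - alpha) * c| <= 1.
    by apply: sq1; have := sqr_ge0 (a - alpha); lra.
  have Ba : `|a| <= 2.
    rewrite -(subrK alpha a); apply: le_trans (ler_normD _ _) _.
    by rewrite (gtr0_norm a0); lra.
  have Bm' : `|m| <= Bm.
    rewrite (_ : m = mu + (m - mu + (a - alpha) * c) - (a - alpha) * c); last by ring.
    apply: le_trans (ler_normB _ _) _; apply: lerD; last by rewrite normrM ler_piMl.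
    by apply: le_trans (ler_normD _ _) _; exact: lerD.
  have Bp' : `|y s - a * y s.-1 - m| <= Bp.
    apply: le_trans (ler_normB _ _) _; apply: lerD => //.
    by apply: le_trans (ler_normB _ _) _; rewrite normrM; apply: lerD => //; rewrite ler_wpM2r.
  have Bq' : `|y s.+1 - a * y s - m| <= Bq.
    apply: le_trans (ler_normB _ _) _; apply: lerD => //.
    by apply: le_trans (ler_normB _ _) _; rewrite normrM; apply: lerD => //; rewrite ler_wpM2r.
  have Bt' : `|t| <= Bt.
    have a2 : 1 <= 1 + a ^+ 2 by rewrite lerDl sqr_ge0.
    rewrite tE normrM normfV (@ger0_norm _ (1 + a ^+ 2)); last by lra.
    rewrite ler_pdivrMr; last by lra.
    apply: (@le_trans _ _ Bt); last first.
      by rewrite ler_peMr// !addr_ge0// ?mulr_ge0// !addr_ge0// mulr_ge0.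
    apply: le_trans (ler_normB _ _) _; apply: lerD => //.
    by rewrite normrM ler_pM.
  split=> //; apply: le_trans (ler_normD _ _) _; apply: lerD => //.
  by rewrite normrM ler_pM.
have [a [m [t Hmin]]] := cls_min_exists (KS (fun k => M k ^+ 2) n) (y s.-1) (y s) (y s.+1)
   alpha mu c k0 n0 (ltW k2) (lexx _) H1 H2 H3 H4 H5.
exists a, m, t; split=> // a' m' t' Hmin'.
have [bt br] := bounds _ _ _ Hmin; have [bt' br'] := bounds _ _ _ Hmin'.
have [|||-> -> ->] := cls_min_unique n0 (lexx _) H1 H2 H3
   (T := 2 * Bt) (Rb := Rb) Hmin' Hmin => //.
- by apply: le_trans (ler_normB _ _) _; rewrite mulr_natl mulr2n lerD.
- by apply: le_trans (ler_normD _ _) _; rewrite mulr_natl mulr2n lerD.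
- lra.
Qed.

Lemma cls_asymptotics : exists n0 : nat,
  (forall n, (n0 <= n)%N -> has_unique_global_minimizer (Qn y s n)) /\
  (forall est : nat -> R * R * R,
    (forall n, (n0 <= n)%N ->
       is_global_minimizer (Qn y s n) (est n).1.1 (est n).1.2 (est n).2) ->
    ((fun n => (est n).1.1) @ \oo --> alpha) /\
    ((fun n => (est n).1.2) @ \oo --> mu) /\
    ((fun n => (est n).2) @ \oo -->
       y s - alpha / (1 + alpha ^+ 2) * (y s.-1 + y s.+1)
           - (1 - alpha) / (1 + alpha ^+ 2) * mu)).
Proof.
have [n1 _ Hn1] := near_unique_min.
exists (maxn n1 s.+1).
have QF n : (maxn n1 s.+1 <= n)%N -> Qn y s n = Fn n.
  rewrite geq_max => /andP[_ sn].
  by apply/funext => a; apply/funext => m; apply/funext => t; rewrite Qn_cls.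
split=> [n nn|est Hest].
  rewrite QF//; apply: Hn1; apply: leq_trans nn; exact: leq_maxl.
have Hmin : \forall n \near \oo, is_global_minimizer (Fn n) (est n).1.1 (est n).1.2 (est n).2.
  by exists (maxn n1 s.+1) => // n /= nn; rewrite -QF//; exact: Hest.
have Hclose := near_min_close.
have sqe (u e : R) : 0 < e -> u ^+ 2 <= e ^+ 2 -> `|u| <= e.
  by move=> e0 u1; rewrite ler_norml; apply/andP; split; nra.
have ca : (fun n => (est n).1.1) @ \oo --> alpha.
  apply/cvgrPdist_le => e e0.
  apply: filterS (filterI Hmin (Hclose _ (exprn_gt0 2 e0))) => n [Hm /(_ _ _ _ Hm) H].
  rewrite distrC; apply: sqe => //.
  have := sqr_ge0 ((est n).1.2 - mu + ((est n).1.1 - alpha) * c); lra.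
have cb : (fun n => (est n).1.2 - mu + ((est n).1.1 - alpha) * c) @ \oo --> (0 : R).
  apply/cvgrPdist_le => e e0.
  apply: filterS (filterI Hmin (Hclose _ (exprn_gt0 2 e0))) => n [Hm /(_ _ _ _ Hm) H].
  rewrite sub0r normrN; apply: sqe => //.
  by have := sqr_ge0 ((est n).1.1 - alpha); lra.
have cst (k : R) : (fun _ : nat => k) @ \oo --> k by exact: cvg_cst.
have cm : (fun n => (est n).1.2) @ \oo --> mu.
  have -> : (fun n => (est n).1.2) = (fun n =>
      ((est n).1.2 - mu + ((est n).1.1 - alpha) * c) + mu - ((est n).1.1 - alpha) * c).
    by apply/funext => n; ring.
  rewrite -[X in _ --> X](_ : 0 + mu - (alpha - alpha) * c = mu); last by ring.
  apply: cvgB; first by apply: cvgD.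
  by apply: cvgM => //; apply: cvgB.
split=> //; split=> //.
have a2 (a : R) : 1 + a ^+ 2 != 0.
  by rewrite lt0r_neq0// ltr_wpDr// sqr_ge0.
have -> : y s - alpha / (1 + alpha ^+ 2) * (y s.-1 + y s.+1)
           - (1 - alpha) / (1 + alpha ^+ 2) * mu =
    (y s - alpha * y s.-1 - mu - alpha * (y s.+1 - alpha * y s - mu)) / (1 + alpha ^+ 2).
  by field; exact: a2.
(* By [cls_min_t] the third estimate is eventually this continuous function of the first two, so its
   limit follows from theirs. *)
pose tn n := let a := (est n).1.1 in let m := (est n).1.2 in
  (y s - a * y s.-1 - m - a * (y s.+1 - a * y s - m)) / (1 + a ^+ 2).
apply: (@cvg_trans _ (tn @ \oo)).
  apply: near_eq_cvg; apply: filterS Hmin => n Hm.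
  by rewrite /tn /= -(cls_min_t Hm).
apply: cvgM.
  apply: cvgB.
    by apply: cvgB => //; apply: cvgB => //; apply: cvgM.
  by apply: cvgM => //; apply: cvgB => //; apply: cvgB => //; apply: cvgM.
apply: cvgV; first exact: a2.
by apply: cvgD => //; exact: (cvgM ca ca).
Qed.

End DeterministicLimit.

Theorem theorem3p3p1 (R : realType) (d : measure_display) (T : measurableType d)
  (P : probability T R) (alpha mu : R) (s theta : nat)
  (X0 : T -> nat) (eps : nat -> T -> nat) (xi : nat -> nat -> T -> nat) :
  0 < alpha < 1 -> (0 < s)%N -> (0 < theta)%N ->
  (* all basic variables are random variables, jointly mutually independent *)
  (forall i, nat_rv (inar_family X0 eps xi i)) ->
  mutually_independent P (inar_family X0 eps xi) ->
  (* (eps_k)_{k>=1} identically distributed, square integrable, not a.s. 0 *)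
  (forall k m, (0 < k)%N -> P (eps k @^-1` [set m]) = P (eps 1%N @^-1` [set m])) ->
  (\int[P]_w (((eps 1%N w)%:R : R) ^+ 2)%:E < +oo)%E ->
  (0 < P (eps 1%N @^-1` [set m | m != 0%N]))%E ->
  (\int[P]_w ((eps 1%N w)%:R : R)%:E = mu%:E)%E ->
  (* xi_{k,j} Bernoulli(alpha) for k, j >= 1 *)
  (forall k j, (0 < k)%N -> (0 < j)%N ->
     P (xi k j @^-1` [set 1%N]) = alpha%:E /\ P (xi k j @^-1` [set 0%N]) = (1 - alpha)%:E) ->
  (* X_0 square integrable *)
  (\int[P]_w (((X0 w)%:R : R) ^+ 2)%:E < +oo)%E ->
  {ae P, forall w,
    exists n0 : nat,
      (forall n, (n0 <= n)%N ->
         has_unique_global_minimizer (Qn (fun k => inar_Y R X0 eps xi s theta k w) s n))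
      /\
      (forall est : nat -> R * R * R,
         (forall n, (n0 <= n)%N ->
            is_global_minimizer (Qn (fun k => inar_Y R X0 eps xi s theta k w) s n)
              (est n).1.1 (est n).1.2 (est n).2) ->
         let Y := fun k => inar_Y R X0 eps xi s theta k w in
         ((fun n => (est n).1.1) @ \oo --> alpha) /\
         ((fun n => (est n).1.2) @ \oo --> mu) /\
         ((fun n => (est n).2) @ \oo -->
            Y s - alpha / (1 + alpha ^+ 2) * (Y s.-1 + Y s.+1)
                - (1 - alpha) / (1 + alpha ^+ 2) * mu))}.
Proof.
move=> alpha01 s0 _ mZ indepZ eps_id eps_sq eps_nz eps_mean xi_bernoulli X0_sq.
have := ae_inar_limits alpha01 mZ indepZ eps_id xi_bernoulli eps_sq eps_mean X0_sq eps_nz.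
apply: filterS => w [lim1 lim2 lower lim3].
exact: (cls_asymptotics theta%:R alpha01 s0 lim1 lim2 lower lim3).
Qed.
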